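(* A finite simple undirected graph $G$ can be explained by a labeled level-1 network if and only if $G\in\mathrm{PolarCat}^{\mathrm{prime}}$, i.e. if and only if for every prime module $M$ of $G$ with $|M|\ge 2$ the quotient graph $G[M]/\mathbb{M}_{\max}(G[M])$ is a polar-cat.
   Context: All graphs are finite, simple and undirected. For a graph $G=(V,E)$ and $W\subseteq V$, $G[W]$ is the induced subgraph, $G-v=G[V\setminus\{v\}]$, and $\overline{G}$ is the complement. The join of two vertex-disjoint graphs is their disjoint union together with all edges between them. A cograph is a graph without induced path on four vertices ($P_4$). Networks: a network on a finite set $X$ is a directed acyclic graph $N=(V,E)$ such that either $V=X=\{x\}$ and $E=\emptyset$, or (N1) there is a unique root $\rho_N$ with indegree $0$ and outdegree $\ge 2$; (N2) $x\in X$ iff $x$ has outdegree $0$ and indegree $1$ (leaves); (N3) every vertex $v\notin X\cup\{\rho_N\}$ has either indegree 1 and outdegree $\ge2$ (tree-vertex) or indegree 2 and outdegree $\ge1$ (hybrid-vertex). Vertices in $V\setminus X$ are inner vertices. $u$ is an ancestor of $v$ ($v\preceq_N u$) if there is a directed path from $u$ to $v$. A network is level-1 if every biconnected component of its underlying undirected graph contains at most one hybrid-vertex. In a level-1 network, for $x,y\in X$ the lowest common ancestor $\mathrm{lca}_N(x,y)$ (the $\preceq_N$-minimal common ancestor of $x,y$) is unique. A labeled network $(N,t)$ is a network with a map $t:V\to\{0,1,\odot\}$ with $t(v)=\odot$ iff $v\in X$. $\mathscr{G}(N,t)$ is the graph on $X$ in which distinct $x,y$ are adjacent iff $t(\mathrm{lca}_N(x,y))=1$;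 $(N,t)$ explains $G$ if $G\cong\mathscr{G}(N,t)$. Pseudo-cographs: $G$ is a pseudo-cograph if $|V(G)|\le2$ or there are induced subgraphs $G_1,G_2$ of $G$ and $v\in V(G)$ with (F1) $V(G)=V(G_1)\cup V(G_2)$, $V(G_1)\cap V(G_2)=\{v\}$, $|V(G_1)|,|V(G_2)|>1$; (F2) $G_1,G_2$ are cographs; (F3) $G-v$ is the join or the disjoint union of $G_1-v$ and $G_2-v$. Then $G$ is a $(v,G_1,G_2)$-pseudo-cograph. Caterpillars: a caterpillar is a rooted tree in which every inner vertex has exactly two children and the inner vertices induce a path with the root at one end; two leaves with a common parent form a cherry. Every cograph $H$ is explained by a unique (up to isomorphism) discriminating labeled tree (its cotree), i.e. one in which adjacent inner vertices have different labels; $H$ is caterpillar-explainable if this tree is a caterpillar. Polar-cats: let $G$ be a $(v,G_1,G_2)$-pseudo-cograph with $|V(G)|\ge3$. $G$ is polarizing if either $G_1,G_2$ are both connected and $G-v$ is the disjoint union of $G_1-v$ and $G_2-v$, or $G_1,G_2$ are both disconnected and $G-v$ is the join of $G_1-v$ and $G_2-v$. $G$ is cat if $|V(G)|\ge4$ and $G_1,G_2$ are caterpillar-explainable such that $v$ is part of a cherry in both caterpillars explaining $G_1$ and $G_2$. If both hold, $G$ is a $(v,G_1,G_2)$-polar-cat; $G$ is a polar-cat if it is a $(v,G_1,G_2)$-polar-cat for some $v,G_1,G_2$. Modules: a module of $G=(V,E)$ is $M\subseteq V$ with $N_G(x)\setminus M=N_G(y)\setminus M$ for all $x,y\in M$.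 It is strong if it does not overlap any other module (for every module $M'$, $M\cap M'\in\{M,M',\emptyset\}$). A strong module $M$ is prime if both $G[M]$ and $\overline{G[M]}$ are connected. $\mathbb{M}_{\max}(G)$ is the set of inclusion-maximal strong modules of $G$ different from $V$ (a partition of $V$ when $|V|>1$). The quotient $G/\mathbb{M}_{\max}(G)$ has vertex set $\mathbb{M}_{\max}(G)$, two modules being adjacent iff every vertex of one is adjacent to every vertex of the other. $\mathrm{PolarCat}^{\mathrm{prime}}$ is the class of graphs $G$ such that $G[M]/\mathbb{M}_{\max}(G[M])$ is a polar-cat for every prime module $M$ of $G$ with $|M|\ge2$. *)

(* Defs.v *)
From mathcomp Require Import all_boot.

Set Implicit Arguments.
Unset Strict Implicit.
Unset Printing Implicit Defensive.

Inductive label := L0 | L1 | Lodot.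

Section Digraph.
Variable W : finType.
Implicit Types (E : rel W) (X S : {set W}) (R : rel W).

Definition indeg E (v : W) := #|[set u | E u v]|.
Definition outdeg E (v : W) := #|[set u | E v u]|.

Definition acyclic E := forall u v, E u v -> ~~ connect E v u.

Definition tree_vertexb E v := (indeg E v == 1) && (2 <= outdeg E v).
Definition hybridb E v := (indeg E v == 2) && (1 <= outdeg E v).

Definition is_network E X :=
  acyclic E /\
  ((#|W| = 1 /\ X = setT /\ forall u v, ~~ E u v) \/
   ((exists r, [/\ indeg E r = 0, 2 <= outdeg E r,
                  (forall r', indeg E r' = 0 -> 2 <= outdeg E r' -> r' = r) &
                  (forall v, v \notin X -> v != r ->
                      tree_vertexb E v \/ hybridb E v)]) /\
    (forall x, x \in X <-> (outdeg E x = 0 /\ indeg E x = 1)))).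

Definition und E : rel W := [rel u v | E u v || E v u].

Definition restr R S : rel W := [rel a b | [&& a \in S, b \in S & R a b]].

Definition connb R S : bool :=
  [forall x in S, forall y in S, connect (restr R S) x y].

Definition biconnb R S : bool := connb R S && [forall v in S, connb R (S :\ v)].

Definition level1 E :=
  forall B : {set W}, maxset (biconnb (und E)) B ->
    #|[set h in B | hybridb E h]| <= 1.

Definition is_lca E (x y w : W) :=
  [/\ connect E w x, connect E w y &
      forall w', connect E w' x -> connect E w' y -> connect E w w' -> w' = w].

Definition labeling X (t : W -> label) := forall v, t v = Lodot <-> v \in X.

Definition is_tree E X := is_network E X /\ forall v, ~~ hybridb E v.

Definition discriminating E X (t : W -> label) :=
  forall u v, E u v -> u \notin X -> v \notin X -> t u <> t v.

Definition consecutive (s : seq W) (a b : W) :=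
  exists i, i.+1 < size s /\
    ((nth a s i = a /\ nth a s i.+1 = b) \/ (nth a s i = b /\ nth a s i.+1 = a)).

Definition caterpillar E X :=
  [/\ is_tree E X,
      (forall v, v \notin X -> outdeg E v = 2) &
      exists s : seq W,
        [/\ uniq s, (forall w, (w \in s) = (w \notin X)),
            (exists r, ohead s = Some r /\ indeg E r = 0) &
            (forall a b, a \in s -> b \in s -> (und E a b <-> consecutive s a b))]].

Definition in_cherry E X (x : W) :=
  exists y p, [/\ y \in X, y != x, E p x & E p y].

End Digraph.

(*    (G = (U, e) with e symmetric and irreflexive)                    *)
Section Graphs.
Variable T : finType.
Variable e : rel T.
Implicit Types (U S M A B : {set T}).

Definition tree_explains (W : finType) U (E : rel W) (leaf : T -> W)
    (t : W -> label) :=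
  [/\ is_tree E (leaf @: U), {in U &, injective leaf},
      labeling (leaf @: U) t &
      forall a b, a \in U -> b \in U -> a != b ->
        (e a b <-> exists w, is_lca E (leaf a) (leaf b) w /\ t w = L1)].

Definition module_in U S : bool :=
  (S \subset U) &&
  [forall x in S, forall y in S, forall z in U :\: S, e x z == e y z].

Definition strong_in U S : bool :=
  module_in U S &&
  [forall S' : {set T}, module_in U S' ==>
     [|| S :&: S' == S, S :&: S' == S' | S :&: S' == set0]].

Definition compl_rel : rel T := [rel x y | (x != y) && ~~ e x y].

Definition prime_module M : bool :=
  [&& strong_in setT M, connb e M & connb compl_rel M].

Definition Mmax M : {set {set T}} :=
  [set S | maxset (fun S => strong_in M S && (S != M)) S].

Definition quot_rel : rel {set T} :=
  [rel A B : {set T} | (A != B) && [forall a in A, forall b in B, e a b]].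

Definition cograph U :=
  ~ exists a b c d, [/\ [/\ a \in U, b \in U, c \in U & d \in U],
                       uniq [:: a; b; c; d],
                       [/\ e a b, e b c & e c d] &
                       [/\ ~~ e a c, ~~ e b d & ~~ e a d]].

Definition joined A B := forall a b, a \in A -> b \in B -> e a b.
Definition separated A B := forall a b, a \in A -> b \in B -> ~~ e a b.

Definition pcog_at U (v : T) U1 U2 :=
  [/\ U1 :|: U2 = U /\ U1 :&: U2 = [set v],
      1 < #|U1| /\ 1 < #|U2|,
      cograph U1 /\ cograph U2 &
      joined (U1 :\ v) (U2 :\ v) \/ separated (U1 :\ v) (U2 :\ v)].

Definition pseudo_cograph U :=
  #|U| <= 2 \/ exists v U1 U2, pcog_at U v U1 U2.

Definition polarizing U (v : T) U1 U2 :=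
  3 <= #|U| /\
  ((connb e U1 /\ connb e U2 /\ separated (U1 :\ v) (U2 :\ v)) \/
   (~~ connb e U1 /\ ~~ connb e U2 /\ joined (U1 :\ v) (U2 :\ v))).

(** G[U1] is caterpillar-explainable (its discriminating cotree is a
    caterpillar) and v is part of a cherry of that caterpillar *)
Definition cat_side U1 (v : T) :=
  exists (W : finType) (E : rel W) (leaf : T -> W) (t : W -> label),
    [/\ tree_explains U1 E leaf t, discriminating E (leaf @: U1) t,
        caterpillar E (leaf @: U1) & in_cherry E (leaf @: U1) (leaf v)].

Definition cat U (v : T) U1 U2 := 4 <= #|U| /\ cat_side U1 v /\ cat_side U2 v.

Definition polar_cat U :=
  exists v U1 U2, [/\ pcog_at U v U1 U2, polarizing U v U1 U2 & cat U v U1 U2].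

End Graphs.

Definition PolarCat_prime (V : finType) (e : rel V) :=
  forall M : {set V}, prime_module e M -> 2 <= #|M| ->
    polar_cat (quot_rel e) (Mmax e M).

(** G is explained by a labeled level-1 network; the leaves of the network
    are identified with the vertices of G via the injective map [leaf]
    (this is the isomorphism G ≅ 𝒢(N,t)). *)
Definition L1_explainable (V : finType) (e : rel V) :=
  exists (W : finType) (E : rel W) (leaf : V -> W) (t : W -> label),
    [/\ is_network E (leaf @: [set: V]), injective leaf, level1 E,
        labeling (leaf @: [set: V]) t &
        forall x y : V, x != y ->
          (e x y <-> exists w, is_lca E (leaf x) (leaf y) w /\ t w = L1)].

(* Main.v *)
Require Import Defs.
From mathcomp Require Import all_boot.
From mathcomp Require Import zify.

Set Implicit Arguments.
Unset Strict Implicit.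
Unset Printing Implicit Defensive.

(** In a network, call [u] bypassed at a hybrid [q] when [u] lies strictly above
    [q] but not above both parents of [q]: [u] is an inner vertex of a side of the
    gall ending in [q].  The only consequences of level-1 that matter are that a
    bypassed vertex is not a hybrid and is bypassed at a single hybrid; both hold
    because otherwise two cycles with different hybrids would share an edge, and
    their union would be biconnected.  If the graph explained on the leaves has only
    trivial modules, then the leaves below the bypassed vertices of a gall, which
    form a module, are all the leaves for some gall, and comparing sets of common
    ancestors exhibits the graph as a polar-cat.  A prime module reduces to this
    case by choosing one leaf in each of its maximal strong submodules.

    Conversely a network is built by induction on the vertex set: a disconnected or
    co-disconnected set is split in two below a new root, and otherwise the polar-cat
    structure of the quotient gives a gall to which the networks of the maximal
    strong submodules are attached.  That the result is level-1 is certified by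
    exhibiting, for any two hybrids, a cut vertex between them. *)

(** * Connected and biconnected sets *)

(** The labels enter the forward direction only through [lcaE]: two pairs of leaves with the same
    common ancestors have the same [is_lca] vertices, hence the same adjacency. All arguments on a
    gall are therefore comparisons of reachability, and the given network can stay as it is when
    attention moves to representatives of the blocks of a prime module. [gall_seq] is the interface
    between the two directions. It mentions neither trees nor cographs; primeness of the graph then
    forces what else a polar-cat asks for: alternating labels in the caterpillars, the polarity of
    both sides and the bound of four vertices. In the converse direction the obstacle is that
    [level1] speaks of maximal biconnected sets, which are awkward to follow while networks are
    glued. A cut vertex between two hybrids survives gluing, and it is confronted with biconnected
    sets only once, for the finished network. *)

Section Connectivity.
Variable T : finType.
Implicit Types (R : rel T) (S A B : {set T}).

(** The crossing edge is the first step of the path that leaves [P]. Most path arguments below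
    amount to a choice of [P]. *)
Lemma connect_exit R (P : pred T) a b :
  connect R a b -> P a -> ~~ P b ->
  exists x y, [/\ P x, ~~ P y, R x y, connect R a x & connect R y b].
Proof.
case/connectP=> p pth ->; elim: p a pth => [|c p IH] a /=; first by move=> _ ->.
case/andP=> Rac pth Pa nPl; case: (boolP (P c)) => Pc.
  have [x [y [Px nPy Rxy cx yb]]] := IH _ pth Pc nPl.
  by exists x, y; split=> //; apply: connect_trans cx; apply: connect1.
by exists a, c; split=> //; apply/connectP; exists p.
Qed.

Lemma connbP R S :
  reflect {in S &, forall x y, connect (restr R S) x y} (connb R S).
Proof.
apply: (iffP forall_inP) => [H x y xS yS|H x xS]; last first.
  by apply/forall_inP=> y yS; apply: H.
by move/forall_inP: (H x xS); apply.
Qed.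

Lemma connb_exit R S (P : pred T) a b :
  connb R S -> a \in S -> b \in S -> P a -> ~~ P b ->
  exists x y, [/\ x \in S, y \in S, P x, ~~ P y & R x y].
Proof.
move=> /connbP H aS bS Pa nPb.
have [x [y [Px nPy /and3P[xS yS Rxy] _ _]]] := connect_exit (H a b aS bS) Pa nPb.
by exists x, y.
Qed.

Lemma restr_sym R S : symmetric R -> symmetric (restr R S).
Proof. by move=> sR x y; rewrite /restr /= sR andbCA. Qed.

Lemma restr_connect_sub R S S' : S \subset S' ->
  subrel (connect (restr R S)) (connect (restr R S')).
Proof.
move=> sub; apply: connect_sub => x y /and3P[xS yS Rxy].
by apply: connect1; rewrite /restr /= !(subsetP sub) // Rxy.
Qed.

Lemma connb_hub R S a : symmetric R ->
  (forall x, x \in S -> connect (restr R S) a x) -> connb R S.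
Proof.
move=> sR H; apply/connbP=> x y xS yS.
apply: connect_trans (H y yS).
by rewrite (sym_connect_sym (restr_sym _ sR)); apply: H.
Qed.

Lemma connbU R A B x : symmetric R -> connb R A -> connb R B ->
  x \in A -> x \in B -> connb R (A :|: B).
Proof.
move=> sR /connbP cA /connbP cB xA xB; apply: (@connb_hub _ _ x) => // y.
case/setUP=> yS.
  by apply: restr_connect_sub (cA _ _ xA yS); apply: subsetUl.
by apply: restr_connect_sub (cB _ _ xB yS); apply: subsetUr.
Qed.

Lemma biconnb_connbD1 R B z : biconnb R B -> connb R (B :\ z).
Proof.
case/andP=> cB /forall_inP H; case: (boolP (z \in B)) => zB; first exact: H.
suff -> : B :\ z = B by [].
by apply/setP=> y; rewrite !inE; case: eqVneq => // ->; rewrite (negPf zB).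
Qed.

(** Whichever vertex is deleted, one of the two shared vertices survives and holds [A] and [B]
    together. *)
Lemma biconnbU R A B x y : symmetric R -> biconnb R A -> biconnb R B ->
  x != y -> x \in A -> x \in B -> y \in A -> y \in B -> biconnb R (A :|: B).
Proof.
move=> sR bA bB xy xA xB yA yB; apply/andP; split.
  by apply: (connbU (x := x)) => //; case/andP: bA bB => ? _ /andP[].
apply/forall_inP=> z _; rewrite setDUl.
have [zx|zx] := eqVneq z x; last first.
  by apply: (connbU (x := x)); rewrite ?biconnb_connbD1 // !inE eq_sym zx.
apply: (connbU (x := y)); rewrite ?biconnb_connbD1 // !inE zx eq_sym xy //.
Qed.

Lemma connect_path_in R S a p : {subset a :: p <= S} -> path R a p ->
  forall x, x \in a :: p -> connect (restr R S) a x.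
Proof.
elim: p a => [|c p IH] a /=.
  by move=> _ _ x; rewrite inE => /eqP->.
move=> sub /andP[Rac pth] x; rewrite inE => /predU1P[->|xp] //.
have sub' y : y \in c :: p -> y \in S by move=> yp; rewrite sub // inE yp orbT.
apply: (@connect_trans _ _ c); last exact: IH.
by apply: connect1; apply/and3P; rewrite sub ?sub' ?mem_head.
Qed.

End Connectivity.

(** * Directed paths and cycles in acyclic digraphs *)

Section Biconnected.
Variables (W : finType) (E : rel W).
Hypothesis acE : acyclic E.

Lemma acyclic_connect_antisym u v : connect E u v -> connect E v u -> u = v.
Proof.
move=> uv vu; apply/eqP; apply/negPn/negP=> nuv.
have [x [y [/eqP-> _ Exy _ yv]]] :=
  connect_exit (P := pred1 u) uv (eqxx u) (contra_neq (fun h => esym h) nuv).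
by move/negP: (acE Exy); apply; apply: connect_trans vu.
Qed.

Lemma und_sym : symmetric (und E).
Proof. by move=> x y; rewrite /und /= orbC. Qed.

Lemma path_connect_last a p : path E a p -> forall x, x \in a :: p ->
  connect E x (last a p).
Proof.
elim: p a => [|c p IH] a /=; first by move=> _ x; rewrite inE => /eqP->.
case/andP=> Eac pth x; rewrite inE => /predU1P[->|xp]; last exact: IH.
by apply: connect_trans (connect1 Eac) (IH _ pth _ (mem_head _ _)).
Qed.

Lemma acyclic_path_uniq a p : path E a p -> uniq (a :: p).
Proof.
elim: p a => [|c p IH] a //= /andP[Eac pth].
rewrite -[_ && uniq p]/(uniq (c :: p)) IH // andbT.
apply/negP=> /(path_connect pth) ca.
by move/negP: (acE Eac).
Qed.

Lemma und_path a p : path E a p -> path (und E) a p.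
Proof. by apply: sub_path => x y; rewrite /und /= => ->. Qed.

Lemma und_connect_sym (S : {set W}) : connect_sym (restr (und E) S).
Proof. exact: sym_connect_sym (restr_sym _ und_sym). Qed.

Lemma path_connect_ends (S : {set W}) a p : {subset a :: p <= S} -> path E a p ->
  forall x, x \in a :: p -> connect (restr (und E) S) a x /\
    connect (restr (und E) S) x (last a p).
Proof.
move=> aS pth; have H := connect_path_in aS (und_path pth).
move=> x xp; split; first exact: H.
by apply: connect_trans (H _ (mem_last _ _)); rewrite und_connect_sym; apply: H.
Qed.

(** By acyclicity the path meets [z] at most once: what precedes [z] stays linked to the start, what
    follows it to the end. *)
Lemma path_connect_setD1 (S : {set W}) a p z x :
  {subset a :: p <= S} -> path E a p -> x \in a :: p -> x != z ->
  connect (restr (und E) (S :\ z)) a x \/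
  connect (restr (und E) (S :\ z)) x (last a p).
Proof.
elim: p a => [|c p IH] a.
  by move=> _ _; rewrite inE => /eqP-> _; left.
move=> aS pth; rewrite inE => /predU1P[->|xp] xz; first by left.
have aS' : a \in S by rewrite aS ?mem_head.
have pS : {subset c :: p <= S} by move=> y yp; rewrite aS // inE yp orbT.
have [Eac pth'] : E a c /\ path E c p by case/andP: pth.
have [az|az] := eqVneq a z.
  right; apply: (path_connect_ends _ pth' xp).2.
  move=> y yp; rewrite in_setD1 pS // andbT.
  apply: contraTneq yp => ->; rewrite -az.
  by case/andP: (acyclic_path_uniq pth).
have [cx|] := IH c pS pth' xp xz; last by right.
(* If [c] is the deleted vertex, [cx] is absurd, since no edge is left at [z]. *)
have [cz|cz] := eqVneq c z.
  have [y [y' [/eqP-> _ /and3P[]]]] :=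
    connect_exit (P := pred1 c) cx (eqxx c) (contra_neq (fun h => etrans h cz) xz).
  by rewrite in_setD1 cz eqxx.
left; apply: connect_trans cx; apply: connect1.
by rewrite /restr /= !in_setD1 az cz aS' pS ?mem_head // /und /= Eac.
Qed.

(** The paths form a cycle, or a single edge if [s] and [t] are empty. After deleting [z] every
    vertex is still linked to [a] or [q], and one of the two paths misses [z] and joins these
    ends. *)
Lemma biconnb_two_paths a q s t :
  path E a (rcons s q) -> path E a (rcons t q) ->
  (forall x, x \in s -> x \notin t) ->
  biconnb (und E) [set x in (a :: rcons s q) ++ (a :: rcons t q)].
Proof.
move=> ps pt dis; set S := [set x in _].
have inS x : x \in S = (x \in a :: rcons s q) || (x \in a :: rcons t q).
  by rewrite in_set mem_cat.
have sS : {subset a :: rcons s q <= S} by move=> x xs; rewrite inS xs.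
have tS : {subset a :: rcons t q <= S}.
  by move=> x xs; rewrite inS xs orbT.
apply/andP; split.
  apply: (@connb_hub _ _ _ a) => [|y]; first exact: und_sym.
  by rewrite inS => /orP[]yin; [apply: (path_connect_ends sS ps yin).1
                              |apply: (path_connect_ends tS pt yin).1].
apply/forall_inP=> z _; set C := connect (restr (und E) (S :\ z)).
have Csym : forall x y, C x y = C y x by move=> x y; apply: und_connect_sym.
have ends x : x \in S -> x != z -> C a x \/ C x q.
  rewrite inS => /orP[]xin xz.
    by have := path_connect_setD1 sS ps xin xz; rewrite last_rcons.
  by have := path_connect_setD1 tS pt xin xz; rewrite last_rcons.
have Cz x : C z x -> x = z.
  move=> zx; apply/eqP/negPn/negP=> xz.
  have [y [y' [/eqP-> _ /and3P[]]]] :=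
    connect_exit (P := pred1 z) zx (eqxx z) xz.
  by rewrite in_setD1 eqxx.
have [za|za] := eqVneq z a.
  apply: (@connb_hub _ _ _ q) => [|x]; first exact: und_sym.
  rewrite in_setD1 => /andP[xz xS]; rewrite -/(C q x) Csym.
  by case: (ends x xS xz) => //; rewrite -za => /Cz h; rewrite h eqxx in xz.
have [zq|zq] := eqVneq z q.
  apply: (@connb_hub _ _ _ a) => [|x]; first exact: und_sym.
  rewrite in_setD1 => /andP[xz xS]; rewrite -/(C a x).
  by case: (ends x xS xz) => //; rewrite -zq Csym => /Cz h; rewrite h eqxx in xz.
have Caq : C a q.
  have aux r : z \notin r -> {subset a :: rcons r q <= S} -> path E a (rcons r q) -> C a q.
    move=> zr rS pr; apply: (path_connect_ends _ pr _).1.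
      move=> x xr; rewrite in_setD1 rS // andbT.
      apply: contraNneq zr => xz; move: xr; rewrite xz inE mem_rcons inE.
      by rewrite (negPf za) (negPf zq).
    by rewrite inE mem_rcons mem_head orbT.
  by have [/dis zt|zs] := boolP (z \in s); [apply: (aux t)|apply: (aux s)].
apply: (@connb_hub _ _ _ a) => [|x]; first exact: und_sym.
rewrite in_setD1 => /andP[xz xS]; rewrite -/(C a x).
by case: (ends x xS xz) => // xq; rewrite /C (connect_trans Caq) // -/(C q x) Csym.
Qed.

End Biconnected.

(** * Galls in level-1 networks *)

(** Serves to cut a path at its last vertex on another path, so that the remainder is disjoint from
    that path. *)
Lemma last_visit (T : eqType) (P : pred T) a p : P a ->
  exists p1 p2, [/\ p = p1 ++ p2, P (last a p1) & all (predC P) p2].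
Proof.
elim/last_ind: p => [|p c IH] Pa; first by exists [::], [::].
have [Pc|nPc] := boolP (P c).
  by exists (rcons p c), [::]; rewrite cats0 last_rcons.
have [p1 [p2 [-> Pl a2]]] := IH Pa.
by exists p1, (rcons p2 c); rewrite rcons_cat all_rcons /= nPc.
Qed.

Section Level1.
Variables (W : finType) (E : rel W) (r : W).
Hypothesis acE : acyclic E.
Hypothesis rootE : forall v, connect E r v.
Hypothesis level1E : forall (B : {set W}) h h', biconnb (und E) B ->
  1 < indeg E h -> 1 < indeg E h' -> h \in B -> h' \in B -> h = h'.

Lemma connect_last_edge u x : connect E u x -> u != x ->
  exists2 p, E p x & connect E u p.
Proof.
move=> ux nux; have nx : ~~ predC1 x x by rewrite /= eqxx.
have [p [y [_ /negPn/eqP-> Ep up _]]] := connect_exit (P := predC1 x) ux nux nx.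
by exists p.
Qed.

(* [u] lies on a side of the gall with hybrid [q], strictly between its two ends. *)
Definition bypassed u q :=
  [&& u != q, connect E u q & [exists p, E p q && ~~ connect E u p]].

Lemma bypassedP u q :
  reflect [/\ u != q, connect E u q & exists2 p, E p q & ~~ connect E u p]
          (bypassed u q).
Proof.
apply: (iffP and3P) => [[uq cuq /exists_inP[p]]|[uq cuq [p Ep np]]]; split=> //.
  by exists p.
by apply/exists_inP; exists p.
Qed.

Lemma bypassed_indeg u q : bypassed u q -> 1 < indeg E q.
Proof.
case/bypassedP=> uq cuq [p Ep np]; have [p' Ep' up'] := connect_last_edge cuq uq.
apply/card_gt1P; exists p, p'; split; rewrite ?inE //.
by apply: contraNneq np => ->.
Qed.

Lemma no_return p q : E p q -> connect E q p -> False.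
Proof. by move=> /acE/negP. Qed.

(** The cycle leaves the root path [pi] at some vertex and closes at [q]. The path is prescribed so
    that the cycles obtained for two hybrids share both [u] and its predecessor [last r pi]. *)
Lemma bypassed_biconnb pi u q : path E r (rcons pi u) -> bypassed u q ->
  exists B : {set W}, [/\ biconnb (und E) B, q \in B, u \in B & last r pi \in B].
Proof.
move=> pthu /bypassedP[uq cuq [p Ep np]].
have [tau ptau] : exists tau, path E u (rcons tau q).
  have [p' Ep' /connectP[tau ptau deftau]] := connect_last_edge cuq uq.
  by exists tau; rewrite rcons_path ptau -deftau.
(* A root path to the parent [p] that is not below [u], cut at its last vertex [a] on [r :: pi]; the
   remainder [sg2] is the second side of the cycle. *)
have /connectP[sg psg lsg] := rootE p.
have [sg1 [sg2 [defsg sg1r avoid]]] :=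
  last_visit sg (mem_head r pi : (mem (r :: pi)) r).
set a := last r sg1 in sg1r.
move: psg lsg; rewrite defsg cat_path last_cat -/a => /andP[_ psg2] lsg2.
have Pt : path E a (rcons sg2 q) by rewrite rcons_path psg2 -lsg2.
have [pi1 [pi2 [defpi a1]]] : exists pi1 pi2, pi = pi1 ++ pi2 /\ last r pi1 = a.
  by case/splitPl: sg1r => pi1 pi2 <-; exists pi1, pi2.
have Ps : path E a (rcons (pi2 ++ u :: tau) q).
  move: pthu; rewrite defpi rcons_cat !cat_path a1 => /andP[_].
  by rewrite rcons_cat cat_path /= rcons_path => /andP[-> ->].
have topx x : x \in sg2 -> connect E x p.
  by move=> xs; rewrite lsg2; apply: path_connect_last => //; rewrite inE xs orbT.
exists [set x in (a :: rcons (pi2 ++ u :: tau) q) ++ (a :: rcons sg2 q)]; split.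
(* [sg2] misses [pi2] by the choice of [a], and misses [u :: tau] because its vertices are above
   [p], which is not below [u]. *)
- apply: biconnb_two_paths => // x; rewrite mem_cat => /orP[xpi|xtau]; apply/negP.
    move=> /(allP avoid) /=; rewrite inE defpi mem_cat xpi.
    by rewrite !orbT.
  move=> /topx xp; move/negP: np; apply; apply: connect_trans xp.
  by apply: (path_connect ptau); rewrite -rcons_cons mem_rcons inE xtau orbT.
- by rewrite in_set mem_cat -rcons_cons mem_rcons mem_head.
- by rewrite in_set mem_cat -rcons_cons mem_rcons inE -cat_cons mem_cat mem_head !orbT.
- rewrite defpi last_cat a1 in_set mem_cat; apply/orP; left.
  rewrite -rcons_cons mem_rcons inE -cat_cons mem_cat mem_last.
  by rewrite orbT.
Qed.

Lemma bypassed_path u q : bypassed u q -> exists pi, path E r (rcons pi u).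
Proof.
case/bypassedP=> _ _ [p _ np].
have ur : r != u by apply: contraNneq np => <-; apply: rootE.
have [v Ev /connectP[pi ppi lpi]] := connect_last_edge (rootE u) ur.
by exists pi; rewrite rcons_path ppi -lpi.
Qed.

(** Otherwise [u] and [q] would be two hybrids on one cycle. *)
Lemma bypassed_not_hybrid u q : bypassed u q -> indeg E u <= 1.
Proof.
move=> b; rewrite leqNgt; apply/negP=> hu.
have [pi ppi] := bypassed_path b; have [B [bB qB uB _]] := bypassed_biconnb ppi b.
have uq := level1E bB hu (bypassed_indeg b) uB qB.
by move: b; rewrite uq; case/bypassedP; rewrite eqxx.
Qed.

(** Both cycles are built on the same root path, so they share [u] and its predecessor, and their
    union is biconnected. *)
Lemma bypassed_uniq u q q' : bypassed u q -> bypassed u q' -> q = q'.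
Proof.
move=> b b'; have [pi ppi] := bypassed_path b.
have [B [bB qB uB lB]] := bypassed_biconnb ppi b.
have [B' [bB' qB' uB' lB']] := bypassed_biconnb ppi b'.
apply: (@level1E (B :|: B') q q'); rewrite ?(bypassed_indeg b) ?(bypassed_indeg b') //.
- apply: (biconnbU (x := u) (y := last r pi)) => //; first exact: und_sym.
  apply/eqP=> ul; move: ppi; rewrite rcons_path -ul => /andP[_ Euu].
  exact: no_return Euu (connect0 _ _).
- by rewrite inE qB.
- by rewrite inE qB' orbT.
Qed.

(** Follow a path from [w] to [x] to the first vertex below [u]. If this is not [u], it has a parent
    that is not below [u], so [u] is bypassed there. *)
Lemma enter_below w u x : connect E w x -> connect E u x -> ~~ connect E u w ->
  connect E w u \/ exists q, [/\ bypassed u q, connect E q x &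
     exists p, [/\ E p q, connect E w p & ~~ connect E u p]].
Proof.
move=> wx ux nuw; have nP : ~~ predC (connect E u) x by rewrite /= ux.
have [p [q [/= nup /negPn uq Epq wp qx]]] := connect_exit wx nuw nP.
have [uq'|nuq] := eqVneq u q.
  by left; rewrite uq' (connect_trans wp) ?connect1.
right; exists q; split=> //; last by exists p.
by apply/bypassedP; split=> //; exists p.
Qed.

End Level1.

(** * Networks explaining prime graphs *)

Definition prime_on (T : finType) (e : rel T) (U : {set T}) :=
  2 < #|U| /\ forall X, module_in e U X -> #|X| <= 1 \/ X = U.

(* The vertex [v] is the leaf below the hybrid of a gall, [s1] and [s2] list the
   leaves hanging off its two sides from top to bottom. *)
Definition gall_seq (T : finType) (e : rel T) (U : {set T}) v (s1 s2 : seq T) :=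
  [/\ uniq (v :: s1 ++ s2), U = [set x in v :: s1 ++ s2],
      pairwise (fun x y => e x y == e x v) s1,
      pairwise (fun x y => e x y == e x v) s2 &
      exists c, forall x y, x \in s1 -> y \in s2 -> e x y = c].

Lemma module_inP (T : finType) (e : rel T) (U S : {set T}) :
  reflect (S \subset U /\ forall x y z, x \in S -> y \in S -> z \in U ->
             z \notin S -> e x z = e y z) (module_in e U S).
Proof.
apply: (iffP andP) => [[sub H]|[sub H]]; split=> //.
  move=> x y z xS yS zU zS; apply/eqP.
  move/forall_inP: H => /(_ x xS) /forall_inP /(_ y yS) /forall_inP; apply.
  by rewrite inE zS.
apply/forall_inP=> x xS; apply/forall_inP=> y yS; apply/forall_inP=> z.
by rewrite inE => /andP[zS zU]; apply/eqP/H.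
Qed.

(** Any two vertices would form a nontrivial module. *)
Lemma prime_on_not_const (T : finType) (e : rel T) (U : {set T}) c :
  prime_on e U -> (forall x y, x \in U -> y \in U -> x != y -> e x y = c) -> False.
Proof.
move=> [U3 pr] H; have /card_gt1P[x [y [xU yU xy]]] : 1 < #|U| by lia.
have sub : [set x; y] \subset U by apply/subsetP=> z /set2P[]->.
have M : module_in e U [set x; y].
  apply/module_inP; split=> // a b z aS bS zU zS.
  have [aU bU] := (subsetP sub _ aS, subsetP sub _ bS).
  by rewrite !H //; apply: contraNneq zS => <-.
by case: (pr _ M) => [|h]; [|move: U3; rewrite -h]; rewrite cards2 xy.
Qed.

Section PrimeNetwork.
Variables (W : finType) (E : rel W) (r : W).
Hypothesis acE : acyclic E.
Hypothesis rootE : forall v, connect E r v.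
Hypothesis level1E : forall (B : {set W}) h h', biconnb (und E) B ->
  1 < indeg E h -> 1 < indeg E h' -> h \in B -> h' \in B -> h = h'.
Hypothesis indegE : forall v, indeg E v <= 2.
Variables (T : finType) (e : rel T) (U : {set T}) (leaf : T -> W).
Hypothesis symE : symmetric e.
Let above w x := connect E w (leaf x).
Hypothesis lcaE : forall x y x' y', x \in U -> y \in U -> x' \in U -> y' \in U ->
  x != y -> x' != y' ->
  (forall w, above w x && above w y = above w x' && above w y') ->
  e x y = e x' y'.

Notation "u ~> v" := (connect E u v) (at level 70).

Lemma enter_belowE w u x : w ~> x -> u ~> x -> ~~ (u ~> w) ->
  w ~> u \/ exists q, [/\ bypassed E u q, q ~> x &
     exists p, [/\ E p q, w ~> p & ~~ (u ~> p)]].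
Proof. exact: enter_below. Qed.

Lemma bypassed_uniqE u q q' : bypassed E u q -> bypassed E u q' -> q = q'.
Proof. exact: (bypassed_uniq acE rootE level1E). Qed.

Lemma bypassed_no_chain u q q' : bypassed E u q -> ~~ bypassed E q q'.
Proof.
move=> b; apply/negP=> /(bypassed_not_hybrid acE rootE level1E).
by rewrite leqNgt (bypassed_indeg b).
Qed.

Lemma above_trans u v x : u ~> v -> above v x -> above u x.
Proof. exact: connect_trans. Qed.

Definition cluster u := [set x in U | above u x].

(** The hypothesis makes the common ancestors of a member and an outside leaf independent of the
    member. *)
Lemma lca_module (X : {set T}) : X \subset U ->
  (forall x x' y w, x \in X -> x' \in X -> y \in U -> y \notin X ->
     above w x -> above w y -> above w x') -> module_in e U X.
Proof.
move=> sub H; apply/module_inP; split=> // x y z xX yX zU zX.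
have [xU yU] := (subsetP sub _ xX, subsetP sub _ yX).
apply: lcaE => //; try by apply: contraNneq zX => <-.
by move=> w; apply/andP/andP=> -[wx wz]; split=> //; apply: H wx wz.
Qed.

(** A common ancestor of an inner and an outer leaf is not below [u]. It can get below [u] only
    through [u] itself, the entry at a hybrid being excluded by hypothesis, so it is above the whole
    cluster. *)
Lemma cluster_module u :
  (forall q x, bypassed E u q -> x \in U -> above q x -> False) ->
  module_in e U (cluster u).
Proof.
move=> dom; apply: lca_module => [|x x' y w]; first by apply/subsetP=> x /setIdP[].
rewrite !inE => /andP[xU ux] /andP[x'U ux'] yU; rewrite yU /= => nuy wx wy.
have [uw|nuw] := boolP (u ~> w); first by rewrite (above_trans uw wy) in nuy.
have [wu|[q [b qx _]]] := enter_belowE wx ux nuw; first exact: above_trans ux'.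
by case: (dom q x).
Qed.

(** * The two sides of one gall and the order of the leaves along them *)

Section Sides.
Variables (q p p' : W).
Hypotheses (Epq : E p q) (Ep'q : E p' q).
Hypothesis parents : forall z, E z q -> z = p \/ z = p'.

(** Being strictly above [q], [u] reaches a parent of [q]; being bypassed, it misses one. The parent
    reached names the side of [u]. *)
Lemma bypassed_side u : bypassed E u q -> (u ~> p) (+) (u ~> p').
Proof.
case/bypassedP=> uq cuq [z Ez nz]; have [z' Ez' uz'] := connect_last_edge cuq uq.
case: (parents Ez) nz => -> /negPf nz; case: (parents Ez') uz' => -> uz'.
- by rewrite uz' in nz.
- by rewrite nz uz'.
- by rewrite nz uz'.
- by rewrite uz' in nz.
Qed.

(** On its way to the parent below [u], [w] must pass [u]: the only other entry is the hybrid [q],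
    which is not above its own parent. *)
Lemma above_gall w u : w ~> p -> w ~> p' -> bypassed E u q -> w ~> u.
Proof.
move=> wp wp' b; have S := bypassed_side b.
have [uw|nuw] := boolP (u ~> w).
  by move: S; rewrite !(connect_trans uw).
have aux z : E z q -> w ~> z -> u ~> z -> w ~> u.
  move=> Ez wz uz; case: (enter_belowE wz uz nuw) => // -[q' [b' q'z _]].
  rewrite (bypassed_uniqE b' b) in q'z.
  by case: (no_return acE Ez q'z).
case: (boolP (u ~> p)) S => [up _|_ /= up']; first exact: (aux p).
exact: (aux p').
Qed.

Lemma above_hybrid w : q != w -> w ~> q ->
  bypassed E w q \/ (w ~> p /\ w ~> p').
Proof.
move=> qw wq; have [|n] := boolP (bypassed E w q); [by left|right].
split; apply/negPn/negP=> nw; move/negP: n; apply; apply/bypassedP.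
  by split; rewrite 1?eq_sym //; exists p.
by split; rewrite 1?eq_sym //; exists p'.
Qed.

(** [u'] is not above [u], so its path to [x] enters the descendants of [u] at a hybrid, and this is
    [q] by uniqueness. *)
Lemma two_sides u u' x : bypassed E u q -> bypassed E u' q -> u ~> p -> u' ~> p' ->
  above u x -> above u' x -> above q x.
Proof.
move=> b b' up u'p' ux u'x; have := bypassed_side b; rewrite up /= => nup'.
have := bypassed_side b'; rewrite u'p' addbT => nu'p.
have nuu' : ~~ (u ~> u') by apply: contraNN nup' => h; apply: connect_trans u'p'.
have [u'u|[q' [b'' q'x _]]] := enter_belowE u'x ux nuu'.
  by rewrite (connect_trans u'u up) in nu'p.
by rewrite (bypassed_uniqE b b'').
Qed.

(** Entering below [u] on the way to [p] cannot happen at [q], so each side is a chain. *)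
Lemma same_side u u' : bypassed E u q -> bypassed E u' q -> u ~> p -> u' ~> p ->
  u ~> u' \/ u' ~> u.
Proof.
move=> b b' up u'p; have [|nuu'] := boolP (u ~> u'); [by left|right].
have [//|[q' [b'' q'p _]]] := enter_belowE u'p up nuu'.
by rewrite -(bypassed_uniqE b b'') in q'p; case: (no_return acE Epq q'p).
Qed.

Variable l : T.
Hypotheses (lU : l \in U) (ql : above q l).
Hypothesis hybrid_leaf : forall x, x \in U -> above q x -> x = l.

(* The leaf [x] hangs lower on the side of [p] the larger [anchors x] is. *)
Definition anchors x := [set u | [&& bypassed E u q, u ~> p & above u x]].
Definition side := [set x in U | (x != l) && (anchors x != set0)].

Lemma sideP x : reflect [/\ x \in U, x != l, ~~ above q x &
   exists u, [/\ bypassed E u q, u ~> p & above u x]] (x \in side).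
Proof.
rewrite inE; apply: (iffP and3P) => [[xU xl /set0Pn[u]]|[xU xl _ [u [b up ux]]]].
  rewrite inE => /and3P[b up ux]; split=> //; last by exists u.
  by apply: contraNN xl => /hybrid_leaf->.
by split=> //; apply/set0Pn; exists u; rewrite inE b up.
Qed.

(** Anchor sets are upward closed in the chain formed by one side, hence nested, and their sizes
    decide the inclusion. *)
Lemma anchors_total x y : #|anchors x| <= #|anchors y| -> anchors x \subset anchors y.
Proof.
move=> le; case: (boolP (anchors x \subset anchors y)) => // /subsetPn[u].
rewrite !inE => /and3P[b up ux]; rewrite b up /= => nuy.
suff sub : anchors y \subset anchors x.
  have /eqP eqa : anchors y == anchors x by rewrite eqEcard sub le.
  have : u \in anchors y by rewrite eqa inE b up ux.
  by rewrite inE b up (negPf nuy).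
apply/subsetP=> u'; rewrite !inE => /and3P[b' u'p u'y]; rewrite b' u'p /=.
have [uu'|u'u] := same_side b b' up u'p; last exact: above_trans ux.
by rewrite (above_trans uu' u'y) in nuy.
Qed.

(** Such a [w] is strictly above [q]. Either it is bypassed, necessarily on the side of [p], and
    then it is an anchor of [x] and so of [y]; or it is above both parents and thus above the whole
    gall. *)
Lemma above_anchors x y w : x \in side -> y \in side ->
  anchors x \subset anchors y -> above w x -> above w l -> above w y.
Proof.
move=> /sideP[xU xl nqx [u [b up ux]]] /sideP[yU yl nqy [u' [b' u'p u'y]]] sub wx wl.
have nqw : ~~ (q ~> w) by apply: contraNN nqx => h; apply: above_trans wx.
have wq : w ~> q.
  have [//|[q' [b'' _ _]]] := enter_belowE wl ql nqw.
  by move: (bypassed_no_chain q' b); rewrite b''.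
have qw : q != w by apply: contraNneq nqw => <-.
have [bw|[wp wp']] := above_hybrid qw wq; last first.
  exact: above_trans (above_gall wp wp' b') u'y.
have := bypassed_side bw; have [wp _|_ /= wp'] := boolP (w ~> p).
  have : w \in anchors y by apply: (subsetP sub); rewrite inE bw wp.
  by rewrite inE => /and3P[].
by rewrite (two_sides b bw up wp' ux wx) in nqx.
Qed.

(** The pairs [x], [y] and [x], [l] have the same common ancestors: an ancestor of both [x] and [y]
    reaches [l] through an anchor of [y] that [x] lacks, or through a parent of [q]. *)
Lemma side_edge x y : x \in side -> y \in side -> #|anchors x| < #|anchors y| ->
  e x y = e x l.
Proof.
move=> xs ys ltxy; have sub := anchors_total (ltnW ltxy).
have [xU xl nqx _] := sideP _ xs; have [yU yl nqy _] := sideP _ ys.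
have xy : x != y by apply: contraTneq ltxy => ->; rewrite ltnn.
apply: lcaE => // w; apply/andP/andP=> -[wx wy]; split=> //; last first.
  exact: above_anchors wx wy.
have [u] : exists2 u, u \in anchors y & u \notin anchors x.
  by apply/subsetPn; apply: contraTN ltxy => /subset_leq_card; rewrite -leqNgt.
rewrite !inE => /and3P[b up uy]; rewrite b up /= => nux.
have nuw : ~~ (u ~> w) by apply: contraNN nux => h; apply: above_trans wx.
have [wu|[q' [b' _ [z [Ez wz _]]]]] := enter_belowE wy uy nuw.
  by apply: above_trans ql; apply: connect_trans wu _; case/bypassedP: b.
rewrite -(bypassed_uniqE b b') in Ez.
exact: above_trans (connect_trans wz (connect1 Ez)) ql.
Qed.

Lemma same_anchors_edge x y : x \in side -> y \in side ->
  anchors x = anchors y -> e x l = e y l.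
Proof.
move=> xs ys eqxy; have [xU xl _ _] := sideP _ xs; have [yU yl _ _] := sideP _ ys.
apply: lcaE => // w; apply/andP/andP=> -[wx wl]; split=> //.
  by apply: above_anchors wx wl => //; rewrite eqxy.
by apply: above_anchors wx wl => //; rewrite eqxy.
Qed.

End Sides.

Section TwoSides.
Variables (q p1 p2 : W) (l : T).
Hypotheses (Ep1 : E p1 q) (Ep2 : E p2 q).
Hypothesis parents : forall z, E z q -> z = p1 \/ z = p2.
Hypotheses (lU : l \in U) (ql : above q l).
Hypothesis hybrid_leaf : forall x, x \in U -> above q x -> x = l.
Hypothesis primeU : prime_on e U.
Hypothesis coverU : forall x, x \in U -> x != l ->
  exists u, bypassed E u q /\ above u x.

Let parents' z : E z q -> z = p2 \/ z = p1.
Proof. by move/parents=> []; [right|left]. Qed.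

Lemma sides_cover x : x \in U -> x != l -> x \in side q p1 l \/ x \in side q p2 l.
Proof.
move=> xU xl; have [u [b ux]] := coverU xU xl.
have := bypassed_side parents b; have [up _|_ /= up] := boolP (u ~> p1).
  by left; rewrite inE xU xl; apply/set0Pn; exists u; rewrite inE b up.
by right; rewrite inE xU xl; apply/set0Pn; exists u; rewrite inE b up.
Qed.

(** The right-hand side mentions neither [x] nor [y]; this is why adjacency across the sides is
    constant. *)
Lemma cross_common x y w : x \in side q p1 l -> y \in side q p2 l ->
  above w x && above w y = (w ~> p1) && (w ~> p2).
Proof.
move=> /(sideP _ hybrid_leaf _)[xU xl nqx [u [b up ux]]].
move=> /(sideP _ hybrid_leaf _)[yU yl nqy [u' [b' u'p u'y]]].
apply/andP/andP=> -[wx wy]; last first.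
  by split; [apply: above_trans ux|apply: above_trans u'y]; apply: (above_gall Ep1 Ep2 parents wx wy).
have nuw : ~~ (u ~> w).
  apply: contraNN nqy => uw; apply: (two_sides parents b b' up u'p _ u'y).
  exact: above_trans wy.
have wq : w ~> q.
  have [wu|[q' [b'' _ [z [Ez wz _]]]]] := enter_belowE wx ux nuw.
    by apply: connect_trans wu _; case/bypassedP: b.
  rewrite -(bypassed_uniqE b b'') in Ez.
  exact: connect_trans wz (connect1 Ez).
have qw : q != w by apply: contraNneq nqx => ->.
have [bw|//] := above_hybrid Ep1 Ep2 qw wq.
have := bypassed_side parents bw; have [wp _|_ /= wp] := boolP (w ~> p1).
  by rewrite (two_sides parents bw b' wp u'p wy u'y) in nqy.
by rewrite (two_sides parents b bw up wp ux wx) in nqx.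
Qed.

Lemma sides_disjoint x : x \in side q p1 l -> x \in side q p2 l -> False.
Proof.
move=> /(sideP _ hybrid_leaf _)[xU xl nqx [u [b up ux]]].
move=> /(sideP _ hybrid_leaf _)[_ _ _ [u' [b' u'p u'x]]].
by rewrite (two_sides parents b b' up u'p ux u'x) in nqx.
Qed.

Lemma cross_const : exists c, forall x y, x \in side q p1 l -> y \in side q p2 l ->
  e x y = c.
Proof.
have [/existsP[x /existsP[y /andP[xs ys]]]|] :=
  boolP [exists x, exists y, (x \in side q p1 l) && (y \in side q p2 l)].
  exists (e x y) => x' y' xs' ys'.
  have sub p z : z \in side q p l -> z \in U by case/(sideP _ hybrid_leaf _).
  apply: lcaE; rewrite ?(sub _ _ xs) ?(sub _ _ ys) ?(sub _ _ xs') ?(sub _ _ ys') //.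
  - by apply/eqP=> h; apply: (sides_disjoint xs'); rewrite h.
  - by apply/eqP=> h; apply: (sides_disjoint xs); rewrite h.
  - by move=> w; rewrite !cross_common.
(* Without a pair across the sides the constant is arbitrary. *)
move=> n; exists true => x y xs ys; move/negP: n; case.
by apply/existsP; exists x; apply/existsP; exists y; rewrite xs.
Qed.

(* Leaves with the same anchors form a module, hence coincide. *)
Lemma anchors_inj : {in side q p1 l &, injective (anchors q p1)}.
Proof.
move=> x y xs ys eqxy.
pose A := [set z in side q p1 l | anchors q p1 z == anchors q p1 x].
have xA : x \in A by rewrite inE xs eqxx.
have yA : y \in A by rewrite inE ys eqxy eqxx.
have subU : A \subset U.
  by apply/subsetP=> z /setIdP[/(sideP _ hybrid_leaf _)[]].
have lA : l \notin A.
  by rewrite inE; apply/negP=> /andP[/(sideP _ hybrid_leaf _)[_]]; rewrite eqxx.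
suff M : module_in e U A.
  have [/card_le1_eqP|AU] := primeU.2 _ M; first by apply.
  by rewrite AU lU in lA.
have [c crossc] := cross_const.
apply/module_inP; split=> // a b z /setIdP[as_ /eqP aE] /setIdP[bs /eqP bE] zU nzA.
have eqab : e a l = e b l by apply: (same_anchors_edge Ep1 Ep2 parents) => //; rewrite aE.
have [->//|zl] := eqVneq z l.
have [zs|zs] := sides_cover zU zl; last by rewrite !crossc.
have nz : anchors q p1 z != anchors q p1 x.
  by apply: contraNneq nzA => h; apply/setIdP; rewrite zs h.
have edge := side_edge Ep1 Ep2 parents lU ql hybrid_leaf.
(* A higher leaf [z] of the same side sees [a] and [b] as it sees [l]; a lower one is seen by them
   as [l] is, and [eqab] applies. *)
have [lt|lt|eqc] := ltngtP #|anchors q p1 z| #|anchors q p1 x|.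
- by rewrite 2!(symE _ z) !edge ?aE ?bE.
- by rewrite !edge ?aE ?bE.
case/eqP: nz; apply/eqP; rewrite eqEcard eqc leqnn andbT.
by apply: (anchors_total Ep1) => //; rewrite eqc.
Qed.

(** Sorting by the number of anchors is strict because [anchors] is injective on the side, so
    [side_edge] applies to every ordered pair. *)
Lemma side_list : exists s, [/\ uniq s, s =i side q p1 l &
  pairwise (fun x y => e x y == e x l) s].
Proof.
pose le x y := #|anchors q p1 x| <= #|anchors q p1 y|.
exists (sort le (enum (side q p1 l))).
have mems : sort le (enum (side q p1 l)) =i side q p1 l.
  by move=> x; rewrite mem_sort mem_enum.
have us : uniq (sort le (enum (side q p1 l))) by rewrite sort_uniq enum_uniq.
split=> //.
have : pairwise le (sort le (enum (side q p1 l))).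
  rewrite -sorted_pairwise; last by move=> a b c; apply: leq_trans.
  by apply: sort_sorted => a b; apply: leq_total.
have : all (mem (side q p1 l)) (sort le (enum (side q p1 l))).
  by apply/allP=> x; rewrite mems.
elim: (sort le _) us => //= x s IH /andP[xs us] /andP[xS aS] /andP[alx pw].
rewrite IH // andbT; apply/allP=> y ys; apply/eqP.
have yS := allP aS _ ys.
apply: (side_edge Ep1 Ep2 parents) => //; rewrite ltn_neqAle [_ <= _](allP alx) // andbT.
apply: contraNneq xs => eqc; suff -> : x = y by [].
apply: anchors_inj => //; apply/eqP; rewrite eqEcard eqc leqnn andbT.
by apply: (anchors_total Ep1) => //; rewrite eqc.
Qed.

End TwoSides.

Lemma gall_parents u q : bypassed E u q ->
  exists p1 p2, [/\ E p1 q, E p2 q & forall z, E z q -> z = p1 \/ z = p2].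
Proof.
move=> b; have /cards2P[p1 [p2 [_ def]]] : #|[set z | E z q]| == 2.
  by rewrite eqn_leq indegE (bypassed_indeg b).
have inE' z : E z q = (z \in [set p1; p2]) by rewrite -def inE.
exists p1, p2; rewrite !inE' !inE !eqxx orbT; split=> // z.
by rewrite inE' => /set2P.
Qed.

Definition gall_leaves q := [set x in U | [exists u, bypassed E u q && above u x]].

(** A common ancestor with an outside leaf is neither bypassed at [q] nor below a bypassed vertex,
    yet it is strictly above [q]. So it is above both parents, hence above every gall leaf. *)
Lemma gall_module q : module_in e U (gall_leaves q).
Proof.
apply: lca_module => [|x x' y w]; first by apply/subsetP=> x /setIdP[].
rewrite !inE => /andP[xU /existsP[u /andP[b ux]]] /andP[x'U /existsP[u' /andP[b' u'x']]] yU.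
rewrite yU => /existsPn ny wx wy.
have {}ny v : bypassed E v q -> ~~ above v y.
  by move=> bv; have := ny v; rewrite bv.
have [p1 [p2 [Ep1 Ep2 parents]]] := gall_parents b.
have nuw : ~~ (u ~> w).
  by apply: contraNN (ny u b) => h; apply: above_trans wy.
suff [wq qw] : w ~> q /\ q != w.
  have [bw|[wp1 wp2]] := above_hybrid Ep1 Ep2 qw wq.
    by rewrite (negPf (ny w bw)) in wy.
  exact: above_trans (above_gall Ep1 Ep2 parents wp1 wp2 b') u'x'.
have [wu|[q' [b'' _ [z [Ez wz _]]]]] := enter_belowE wx ux nuw.
  case/bypassedP: b => uq cuq _; split; first exact: connect_trans cuq.
  by apply: contraNneq uq => qw; apply/eqP; apply: (acyclic_connect_antisym acE); rewrite // qw.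
rewrite -(bypassed_uniqE b b'') in Ez; split.
  exact: connect_trans wz (connect1 Ez).
by apply/eqP=> qw; rewrite -qw in wz; case: (no_return acE Ez wz).
Qed.

(** The gall is found from a vertex [w] whose cluster is neither trivial nor all of [U]: this
    cluster is not a module, so [w] is bypassed. *)
Lemma prime_network_gall_seq : prime_on e U -> exists v s1 s2, gall_seq e U v s1 s2.
Proof.
move=> primeU; have [U3 pr] := primeU.
have [/existsP[w /andP[Lw1 LwU]]|small] :=
  boolP [exists w, (1 < #|cluster w|) && (cluster w != U)]; last first.
  (* Without such a [w] the common ancestors of any two leaves are exactly the vertices with cluster
     [U], so adjacency is constant. *)
  have /card_gt1P[x [y [xU yU xy]]] : 1 < #|U| by lia.
  have full w a b : a \in U -> b \in U -> a != b ->
      above w a && above w b = (cluster w == U).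
    move=> aU bU ab; apply/andP/eqP=> [[wa wb]|eqU].
      apply/eqP; move/existsPn: small => /(_ w); rewrite negb_and negbK.
      suff -> : 1 < #|cluster w| by [].
      by apply/card_gt1P; exists a, b; rewrite !inE aU bU.
    by move: aU bU; rewrite -eqU !inE => /andP[_ ->] /andP[_ ->].
  case: (@prime_on_not_const _ e U (e x y) primeU) => a b aU bU ab.
  by apply: lcaE => // w; rewrite !full.
have [q [bw [l [lU ql]]]] : exists q, bypassed E w q /\ exists l, l \in U /\ above q l.
  have [|/existsPn n] := boolP [exists q, bypassed E w q && [exists l in U, above q l]].
    by case/existsP=> q /andP[b /exists_inP[l lU ql]]; exists q; split=> //; exists l.
  have M : module_in e U (cluster w).
    apply: cluster_module => q x b xU qx; have := n q; rewrite b.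
    by case/exists_inP; exists x.
  by case: (pr _ M) => [|h]; [rewrite leqNgt Lw1 | rewrite h eqxx in LwU].
have clU : cluster w \subset U by apply/subsetP=> x /setIdP[].
(* The hybrid [q] is bypassed nowhere, so its cluster is a module; contained in that of [w], it is
   not [U], so it is a single leaf. *)
have hybrid_leaf x : x \in U -> above q x -> x = l.
  move=> xU qx; have M : module_in e U (cluster q).
    apply: cluster_module => q' z b'; have := bypassed_no_chain q' bw.
    by rewrite b'.
  case: (pr _ M) => [/card_le1_eqP|h]; first by apply; rewrite inE ?xU ?lU.
  case/negP: LwU; rewrite eqEsubset clU -h; apply/subsetP=> z.
  rewrite !inE => /andP[-> qz]; apply: above_trans qz.
  by case/bypassedP: bw.
(* The gall leaves include the cluster of [w], hence more than one leaf, so this module is [U]. *)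
have coverU x : x \in U -> x != l -> exists u, bypassed E u q /\ above u x.
  move=> xU _; suff : x \in gall_leaves q.
    by rewrite inE xU => /existsP[u /andP[]]; exists u.
  case: (pr _ (gall_module q)) => [|-> //]; rewrite leqNgt; case/negP.
  apply: leq_trans Lw1 _; apply/subset_leq_card/subsetP=> z.
  by rewrite !inE => /andP[-> wz]; apply/existsP; exists w; rewrite bw.
have [p1 [p2 [Ep1 Ep2 parents]]] := gall_parents bw.
have parents' z : E z q -> z = p2 \/ z = p1 by move/parents=> []; [right|left].
have [s1 [us1 ms1 pw1]] := side_list Ep1 Ep2 parents lU ql hybrid_leaf primeU coverU.
have [s2 [us2 ms2 pw2]] := side_list Ep2 Ep1 parents' lU ql hybrid_leaf primeU coverU.
have sU p x : x \in side q p l -> x \in U /\ x != l.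
  by case/(sideP _ hybrid_leaf _).
exists l, s1, s2; split=> //.
- rewrite /= cat_uniq us1 us2 andbT mem_cat ms1 ms2; apply/andP; split.
    by apply/norP; split; apply/negP=> /sU[_]; rewrite eqxx.
  apply/hasPn=> x; rewrite ms2 => x2; rewrite /= ms1; apply/negP=> x1.
  exact: (sides_disjoint parents hybrid_leaf x1 x2).
- apply/setP=> x; rewrite !inE mem_cat ms1 ms2.
  apply/idP/or3P=> [xU|[/eqP->|/sU[]|/sU[]] //].
  have [->|xl] := eqVneq x l; first exact: Or31.
  by have [] := sides_cover parents coverU xU xl; [apply: Or32|apply: Or33].
- have [c H] := cross_const Ep1 Ep2 parents hybrid_leaf.
  by exists c => x y; rewrite ms1 ms2; apply: H.
Qed.

End PrimeNetwork.

(** * Caterpillars *)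

Lemma is_lca_eq (W : finType) (E : rel W) x y x' y' w :
  (forall u, connect E u x && connect E u y = connect E u x' && connect E u y') ->
  is_lca E x y w -> is_lca E x' y' w.
Proof.
move=> H [wx wy mn]; have := H w; rewrite wx wy => /esym/andP[wx' wy'].
split=> // u ux uy wu; have := H u; rewrite ux uy => /andP[] *; exact: mn.
Qed.

Lemma is_lca_sym (W : finType) (E : rel W) x y w : is_lca E x y w -> is_lca E y x w.
Proof. by apply: is_lca_eq => u; rewrite andbC. Qed.

Lemma lca_label_sym (W : finType) (E : rel W) (t : W -> label) x y :
  (exists w, is_lca E x y w /\ t w = L1) <-> (exists w, is_lca E y x w /\ t w = L1).
Proof. by split=> -[w [/is_lca_sym ? ?]]; exists w. Qed.

Section IncreasingDigraph.
Variables (n : nat) (E R : rel 'I_n).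
Hypothesis incE : forall x y, E x y -> x < y.

Lemma incr_connect_leq x y : connect E x y -> x <= y.
Proof.
case/connectP=> p pth ->; elim: p x pth => //= z p IH x /andP[/incE xz /IH].
by apply: leq_trans; apply: ltnW.
Qed.

Lemma incr_acyclic : acyclic E.
Proof.
by move=> u v /incE uv; apply/negP=> /incr_connect_leq; rewrite leqNgt uv.
Qed.

(** The induction from [R] to paths peels off the last edge and descends on the value of the
    endpoint. The caterpillar and the gall digraph obtain arithmetic reachability in this way. *)
Lemma incr_connectE : reflexive R ->
  (forall x y z, E x y -> R y z -> R x z) ->
  (forall x z, R x z -> x != z -> exists2 y, E y z & R x y) ->
  connect E =2 R.
Proof.
move=> reflR stepR lastR x z; apply/idP/idP=> [/connectP[p pth ->]|].
  by elim: p x pth => //= y p IH x /andP[Exy /IH]; apply: stepR.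
have [m] := ubnP z; elim: m z => // m IH z ltzm Rxz.
have [->|xz] := eqVneq x z; first exact: connect0.
have [y Eyz Rxy] := lastR _ _ Rxz xz.
apply: connect_trans (connect1 Eyz); apply: IH Rxy.
by rewrite -ltnS (leq_trans _ ltzm) // ltnS incE.
Qed.

End IncreasingDigraph.

Section CatNetwork.
Variable k : nat.
Hypothesis k_gt0 : 0 < k.
Let V := 'I_(k + k).+1.

(* The inner vertices are [0 .. k - 1] from the root down; leaf [k + i] hangs off
   the inner vertex [i], except that leaf [k + k] hangs off [k - 1]. *)
Definition cat_parent (w : nat) := if w < k then w.-1 else minn (w - k) k.-1.
Definition cat_edge : rel V := [rel u w : V | (0 < w) && (u == cat_parent w :> nat)].
Definition cat_reach : rel V :=
  [rel u w : V | (u == w) || (u < k) && (if w < k then u <= w else u <= w - k)].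

Lemma cat_edge_incr x y : cat_edge x y -> x < y.
Proof. by rewrite /cat_edge /cat_parent /=; case: ifP; lia. Qed.

Lemma cat_connectE : connect cat_edge =2 cat_reach.
Proof.
apply: incr_connectE cat_edge_incr _ _ _ => [x|x y z|x z].
- by rewrite /cat_reach /= eqxx.
- rewrite /cat_edge /cat_reach /cat_parent /= -!val_eqE /=.
  by do !case: ifP; lia.
rewrite /cat_reach /cat_edge /cat_parent /= => H xz.
exists (inord (if z < k then z.-1 else minn (z - k) k.-1)).
  have := ltn_ord z; rewrite inordK; first by rewrite eqxx andbT; move: H xz; rewrite -!val_eqE /=; case: ifP; lia.
  by case: ifP; lia.
move: H xz; have := ltn_ord z; have := ltn_ord x.
rewrite -!val_eqE /= inordK; last by case: ifP; lia.
by do !case: ifP; lia.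
Qed.

Lemma cat_indeg w : indeg cat_edge w = (0 < w).
Proof.
rewrite /indeg; have [w0|w0] := posnP w.
  by apply/eqP; rewrite cards_eq0; apply/eqP/setP=> u; rewrite !inE /cat_edge /= w0.
rewrite -[true : nat](cards1 (inord (cat_parent w) : V)); congr #|pred_of_set _|.
apply/setP=> u; rewrite !inE /cat_edge /= w0 -val_eqE /= inordK //.
by rewrite /cat_parent; have := ltn_ord w; case: ifP; lia.
Qed.

Lemma cat_outdeg u : outdeg cat_edge u = if u < k then 2 else 0.
Proof.
have := ltn_ord u; rewrite /outdeg; case: ifP => uk ult; last first.
  apply/eqP; rewrite cards_eq0; apply/eqP/setP=> w; rewrite !inE /cat_edge /= /cat_parent.
  by have := ltn_ord w; case: ifP; lia.
pose a : V := inord (k + u); pose b : V := inord (if u.+1 < k then u.+1 else k + k).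
have va : val a = k + u by rewrite /a /= inordK //; lia.
have vb : val b = if u.+1 < k then u.+1 else k + k by rewrite /b /= inordK //; case: ifP; lia.
have ab : a != b by rewrite -val_eqE va vb; case: ifP; lia.
transitivity #|[set a; b]|; last by rewrite cards2 ab.
congr #|pred_of_set _|; apply/setP=> w; rewrite !inE -!val_eqE va vb /cat_edge /= /cat_parent.
by have := ltn_ord w; do !case: ifP; lia.
Qed.

(** The leaf that hangs higher decides. As [a < b], [a] is not the leaf [k + k], so its parent is
    [a - k]. *)
Lemma cat_lca (a b w : V) : k <= a -> a < b ->
  is_lca cat_edge a b w <-> w = a - k :> nat.
Proof.
move=> ka ab; have ltb := ltn_ord b.
have anc u : connect cat_edge u a && connect cat_edge u b = (u <= a - k).
  rewrite !cat_connectE /cat_reach /= -!val_eqE /=; have := ltn_ord u.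
  by do !case: ifP; lia.
split=> [[wa wb mn]|wE].
  pose c : V := inord (a - k); have vc : c = a - k :> nat by rewrite inordK //; lia.
  have := anc c; rewrite vc leqnn => /andP[ca cb].
  have := anc w; rewrite wa wb => /esym lew.
  rewrite -(mn c) // cat_connectE /cat_reach /= vc.
  by case: ifP; lia.
have := anc w; rewrite wE leqnn => /andP[wa wb]; split=> // u ua ub.
have := anc u; rewrite ua ub => /esym leu.
move=> /(incr_connect_leq cat_edge_incr) lewu.
by apply: val_inj => /=; lia.
Qed.

Let leaves : {set V} := [set w : V | k <= w].

Lemma cat_network : is_network cat_edge leaves.
Proof.
split; first exact: incr_acyclic cat_edge_incr.
right; split; last first.
  move=> x; rewrite inE cat_indeg cat_outdeg; case: ifP; first by lia.
  by split; lia.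
exists ord0; rewrite cat_indeg cat_outdeg k_gt0; split=> //.
  by move=> r'; rewrite cat_indeg => r0 _; apply: val_inj => /=; lia.
move=> v; rewrite inE -val_eqE /= => vk v0; left.
by rewrite /tree_vertexb cat_indeg cat_outdeg; case: ifP; lia.
Qed.

Lemma cat_tree : is_tree cat_edge leaves.
Proof.
split; first exact: cat_network.
by move=> v; rewrite /hybridb cat_indeg; case: (0 < v).
Qed.

Lemma cat_caterpillar : caterpillar cat_edge leaves.
Proof.
split; first exact: cat_tree.
  by move=> v; rewrite inE cat_outdeg; case: ifP; lia.
pose s : seq V := [seq inord i | i <- iota 0 k].
have sz : size s = k by rewrite size_map size_iota.
have nths c i : i < k -> nth c s i = i :> nat.
  by move=> ik; rewrite (nth_map 0) ?size_iota // nth_iota // inordK //; lia.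
exists s; split.
- rewrite map_inj_in_uniq ?iota_uniq // => i j; rewrite !mem_iota => hi hj /(congr1 val).
  by rewrite /= !inordK; lia.
- move=> w; rewrite inE -ltnNge; apply/mapP/idP=> [[i]|wk].
    by rewrite mem_iota => ik ->; rewrite inordK; lia.
  by exists (val w); rewrite ?mem_iota ?inord_val.
- exists (inord 0); split; last by rewrite cat_indeg inordK.
  by rewrite /s; case: (k) k_gt0.
have ltk (a : V) : a \in s -> a < k.
  by case/mapP=> i; rewrite mem_iota => ik ->; rewrite inordK; lia.
move=> a b /ltk ak /ltk bk; rewrite /und /cat_edge /cat_parent /= ak bk /consecutive sz.
split; last first.
  case=> i [ik [[]|[]]] /(congr1 val) + /(congr1 val);
    by rewrite /= !nths; lia.
case/orP=> /andP[pos /eqP def].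
  by exists a; split; [lia|left; split; apply: val_inj; rewrite /= nths; lia].
by exists b; split; [lia|right; split; apply: val_inj; rewrite /= nths; lia].
Qed.

End CatNetwork.

Section CatSide.
Variables (T : finType) (e : rel T).
Hypothesis symE : symmetric e.

(** The [i]-th element of [s] hangs off inner vertex [i], labelled by its adjacency to [v], and [v]
    is the leaf [k + k]. The alternation hypothesis makes the tree discriminating. *)
Lemma cat_side_chain (s : seq T) v : s != [::] -> uniq (rcons s v) ->
  pairwise (fun x y => e x y == e x v) s ->
  (forall i, i.+1 < size s -> e (nth v s i) v != e (nth v s i.+1) v) ->
  cat_side e [set x in rcons s v] v.
Proof.
move=> s0 us pw alt; set k := size s.
have k0 : 0 < k by rewrite /k; case: (s) s0.
pose t (u : 'I_(k + k).+1) :=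
  if u < k then (if e (nth v s u) v then L1 else L0) else Lodot.
pose leaf x : 'I_(k + k).+1 := inord (k + index x (rcons s v)).
have ixk x : x \in rcons s v -> index x (rcons s v) <= k.
  by rewrite -index_mem size_rcons.
have leafE x : x \in rcons s v -> leaf x = k + index x (rcons s v) :> nat.
  by move=> /ixk h; rewrite /leaf inordK //; lia.
have leavesE : leaf @: [set x in rcons s v] = [set w : 'I_(k + k).+1 | k <= w].
  apply/setP=> w; rewrite inE; apply/imsetP/idP=> [[x]|kw].
    by rewrite inE => xs ->; rewrite leafE //; lia.
  have wk : w - k < size (rcons s v) by have := ltn_ord w; rewrite size_rcons -/k; lia.
  exists (nth v (rcons s v) (w - k)); first by rewrite inE mem_nth.
  by apply: val_inj; rewrite /= leafE ?mem_nth // index_uniq //; lia.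
have edge x y : x \in rcons s v -> y \in rcons s v ->
    index x (rcons s v) < index y (rcons s v) -> e x y = e x v.
  have gen i j : i < j -> j <= k ->
      e (nth v (rcons s v) i) (nth v (rcons s v) j) = e (nth v (rcons s v) i) v.
    move=> ij jk; rewrite !nth_rcons -/k (leq_trans ij jk).
    move: jk; rewrite leq_eqVlt => /predU1P[->|jk]; first by rewrite ltnn eqxx.
    by rewrite jk; apply/eqP; apply: (pairwiseP v pw); rewrite ?inE // (ltn_trans ij).
  by move=> xs ys lt; have := gen _ _ lt (ixk y ys); rewrite !nth_index.
have explE x y : x \in rcons s v -> y \in rcons s v ->
    index x (rcons s v) < index y (rcons s v) ->
    (e x y <-> exists w, is_lca (@cat_edge k) (leaf x) (leaf y) w /\ t w = L1).
  move=> xs ys lt; have [lx ly] := (leafE x xs, leafE y ys).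
  have H w : is_lca (@cat_edge k) (leaf x) (leaf y) w <-> w = index x (rcons s v) :> nat.
    have kx : k <= leaf x by lia.
    have xy : leaf x < leaf y by lia.
    by have := cat_lca k0 w kx xy; rewrite [in _ - k]lx addKn.
  have xk : index x (rcons s v) < k by apply: leq_trans lt (ixk y ys).
  have tE (w : 'I_(k + k).+1) : w = index x (rcons s v) :> nat ->
      t w = if e x v then L1 else L0.
    move=> wE; rewrite /t wE xk; suff -> : nth v s (index x (rcons s v)) = x by [].
    by rewrite -[RHS](nth_index v xs) nth_rcons -/k xk.
  rewrite (edge x y) //; split=> [exv|[w [/H/tE->]]]; last by case: (e x v).
  have v' : (inord (index x (rcons s v)) : 'I_(k + k).+1) = index x (rcons s v) :> nat.
    by rewrite inordK //; lia.
  by exists (inord (index x (rcons s v))); split; [apply/H | rewrite tE ?exv].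
exists 'I_(k + k).+1, (@cat_edge k), leaf, t; rewrite leavesE; split.
- rewrite /tree_explains leavesE; split; first exact: cat_tree.
  + move=> x y; rewrite !inE => xs ys /(congr1 val); rewrite /= !leafE // => /addnI eqi.
    by rewrite -(nth_index v xs) eqi nth_index.
  + by move=> w; rewrite inE /t; case: ltnP => // wk; split=> //; case: ifP.
  + move=> x y; rewrite !inE => xs ys xy.
    have [lt|lt|eqi] := ltngtP (index x (rcons s v)) (index y (rcons s v)).
    * exact: explE.
    * by rewrite symE (explE y x ys xs lt); apply: lca_label_sym.
    * by move/eqP: xy; case; rewrite -(nth_index v xs) eqi nth_index.
- move=> u w; rewrite /cat_edge /cat_parent /= !inE -!ltnNge => + uk wk.
  rewrite /t uk wk => /andP[w0 /eqP uE]; have := alt u.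
  have -> : u.+1 = w by lia.
  by move=> /(_ wk); do 2!case: (e _ v).
- exact: cat_caterpillar.
have vs : v \in rcons s v by rewrite mem_rcons mem_head.
have iv : index v (rcons s v) = k.
  by rewrite -cats1 index_cat /= eqxx addn0; move: us; rewrite rcons_uniq => /andP[/negPf->].
(* The sibling of [v] is the leaf of the last element of [s]. *)
exists (inord (k + k.-1)), (inord k.-1); split.
- by rewrite inE inordK; lia.
- by apply/eqP=> /(congr1 (@nat_of_ord _)); rewrite leafE // iv inordK; lia.
- by rewrite /cat_edge /cat_parent /= [leaf v : nat]leafE // iv !inordK; try lia; case: ifP; lia.
- by rewrite /cat_edge /cat_parent /= !inordK; try lia; case: ifP; lia.
Qed.

End CatSide.

(** * Polar-cats *)

Section CatSideInv.
Variables (T : finType) (e : rel T) (U : {set T}) (v : T).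
Variables (W : finType) (E : rel W) (leaf : T -> W) (t : W -> label).
Hypothesis vU : v \in U.
Hypothesis explE : tree_explains e U E leaf t.
Hypothesis catE : caterpillar E (leaf @: U).
Hypothesis cherryE : in_cherry E (leaf @: U) (leaf v).

(** Leaves other than [v] are sorted by the position of their parent on the spine. The common
    ancestors of two leaves are the spine vertices down to the higher parent, and [v] has the lowest
    one, so each leaf is adjacent to the later ones as it is to [v]. *)
Lemma caterpillar_chain : exists s, [/\ uniq (rcons s v), U = [set x in rcons s v] &
  pairwise (fun x y => e x y == e x v) s].
Proof.
have [[net nohyb] leaf_inj _ edge] := explE; have acE := net.1.
have [_ out2 [s [us mems [r0 [headr r0in]] cons]]] := catE.
have [leafP indeg1] :
  (forall x, x \in leaf @: U <-> outdeg E x = 0 /\ indeg E x = 1) /\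
  (forall x, indeg E x <= 1).
  case: net => _ [[W1 _]|[[r [rin _ _ H]] leafP]].
    have [y [p [_ yv _ _]]] := cherryE.
    by have := max_card (mem [set y; leaf v]); rewrite cards2 yv W1.
  split=> // x; have [/leafP[_ ->]//|xX] := boolP (x \in leaf @: U).
  have [->|xr] := eqVneq x r; first by rewrite rin.
  case: (H x xX xr) => [/andP[/eqP->]//|h].
  by move: (nohyb x); rewrite h.
have parent_uniq p p' x : E p x -> E p' x -> p = p'.
  by move=> Ep Ep'; apply: (card_le1_eqP (indeg1 x)); rewrite inE.
have no_leaf_child u x : u \in leaf @: U -> ~~ E u x.
  move=> /leafP[/eqP]; rewrite cards_eq0 => /eqP/setP/(_ x).
  by rewrite !inE => -> _.
have nth_notin d i : i < size s -> nth d s i \notin leaf @: U.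
  by move=> ik; rewrite -mems mem_nth.
have s0 : 0 < size s by case: (s) headr.
have nthcons d i : i.+1 < size s -> und E (nth d s i) (nth d s i.+1).
  move=> ik; apply/cons; rewrite ?mem_nth //; first exact: ltnW.
  exists i; split=> //; left; split; apply: set_nth_default => //; exact: ltnW.
(* The spine starts at the root and indegrees are at most one, so no spine edge points upwards. *)
have down d i : i.+1 < size s -> E (nth d s i) (nth d s i.+1).
  elim: i => [|i IH] ik; have := nthcons d _ ik; case/orP=> // up.
    move/eqP: r0in; rewrite cards_eq0 => /eqP/setP/(_ (nth d s 1)).
    by move: headr up; case: (s) => //= a s' [->]; rewrite !inE => ->.
  have /eqP := parent_uniq _ _ _ up (IH (ltnW ik)).
  by rewrite nth_uniq ?(ltnW (ltnW ik)) // (gtn_eqF (leqnSn i.+1)).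
pose ix x := find (fun u => E u (leaf x)) s.
have ixP x : x \in U -> ix x < size s /\ E (nth (leaf x) s (ix x)) (leaf x).
  move=> xU; have xX : leaf x \in leaf @: U by apply: imset_f.
  have [p pE] : exists p, E p (leaf x).
    have [_ h] := (leafP _).1 xX.
    have /card_gt0P[p] : 0 < #|[set u | E u (leaf x)]| by rewrite -/(indeg E _) h.
    by rewrite inE; exists p.
  have hs : has (fun u => E u (leaf x)) s.
    apply/hasP; exists p => //; rewrite mems; apply/negP=> /(no_leaf_child _ (leaf x)).
    by rewrite pE.
  by rewrite /ix -has_find; split=> //; apply: (nth_find _ hs).
have anc_spine d w j : j < size s -> connect E w (nth d s j) ->
    w \in s /\ index w s <= j.
  elim: j => [|j IH] jk cw.
    have [->|nw] := eqVneq w (nth d s 0); first by rewrite mem_nth ?index_uniq.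
    have [p Ep _] := connect_last_edge cw nw.
    move/eqP: r0in; rewrite cards_eq0 => /eqP/setP/(_ p).
    by move: headr Ep; case: (s) => //= a s' [->]; rewrite !inE => ->.
  have [->|nw] := eqVneq w (nth d s j.+1); first by rewrite mem_nth ?index_uniq.
  have [p Ep wp] := connect_last_edge cw nw.
  rewrite (parent_uniq _ _ _ Ep (down d _ jk)) in wp.
  by have [? ?] := IH (ltnW jk) wp; split=> //; apply: leqW.
have spine_down d i j : i <= j -> j < size s -> connect E (nth d s i) (nth d s j).
  elim: j => [|j IH]; first by rewrite leqn0 => /eqP->.
  rewrite leq_eqVlt => /predU1P[->//|ij] jk.
  exact: connect_trans (IH ij (ltnW jk)) (connect1 (down d _ jk)).
have ancE x w : x \in U ->
    connect E w (leaf x) = (w == leaf x) || (w \in s) && (index w s <= ix x).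
  move=> xU; have [ixs ixE] := ixP x xU; apply/idP/orP=> [cw|[/eqP->//|/andP[ws le]]].
    have [|nw] := eqVneq w (leaf x); [by left|right].
    have [p Ep wp] := connect_last_edge cw nw.
    rewrite (parent_uniq _ _ _ Ep ixE) in wp.
    by have [-> ->] := anc_spine _ _ _ ixs wp.
  apply: connect_trans (connect1 ixE).
  by rewrite -(nth_index (leaf x) ws); apply: spine_down.
have leafNs x : x \in U -> leaf x \notin s.
  by move=> xU; rewrite mems negbK imset_f.
have common x y w : x \in U -> y \in U -> x != y -> ix x <= ix y ->
    connect E w (leaf x) && connect E w (leaf y) = (w \in s) && (index w s <= ix x).
  move=> xU yU xy le; rewrite !ancE //.
  have [->|nx] /= := eqVneq w (leaf x).
    rewrite (negPf (leafNs x xU)) /= orbF; apply/eqP=> /leaf_inj eqxy.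
    by rewrite eqxy ?eqxx in xy.
  have [->|_] /= := eqVneq w (leaf y); first by rewrite (negPf (leafNs y yU)).
  case: (w \in s) => //=; case: leqP => //= h.
  by apply: leq_trans le.
have lcaE x y y' : x \in U -> y \in U -> y' \in U -> x != y -> x != y' ->
    ix x <= ix y -> ix x <= ix y' -> e x y = e x y'.
  move=> xU yU y'U xy xy' le le'.
  suff : e x y <-> e x y' by case: (e x y); case: (e x y') => // -[h h'];
    [have := h isT | have := h' isT].
  have eqc w : connect E w (leaf x) && connect E w (leaf y) =
     connect E w (leaf x) && connect E w (leaf y') by rewrite !common.
  rewrite !edge //; split=> -[w [lw tw]]; exists w; split=> //; apply: is_lca_eq lw => //.
(* A parent of [v] other than the last spine vertex would have three children: [v], its sibling and
   the next spine vertex. *)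
have ixv x : x \in U -> ix x <= ix v.
  move=> xU; suff -> : ix v = (size s).-1 by have := (ixP x xU).1; lia.
  have [ivs ivE] := ixP v vU; set p := nth _ _ _ in ivE.
  apply/eqP; rewrite eqn_leq; apply/andP; split; first by lia.
  rewrite leqNgt; apply/negP=> lt; have lt' : (ix v).+1 < size s by lia.
  have [y [p' [yX yv Ep'v Ep'y]]] := cherryE.
  rewrite (parent_uniq _ _ _ Ep'v ivE) in Ep'y.
  have := out2 p (nth_notin _ _ ivs); rewrite /outdeg.
  have sub : [set leaf v; y; nth (leaf v) s (ix v).+1] \subset [set w | E p w].
    by apply/subsetP=> w; rewrite !inE => /orP[/orP[]|] /eqP-> //; apply: down.
  have := subset_leq_card sub; rewrite setUC cardsU1 cards2 eq_sym yv !inE.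
  have := nth_notin (leaf v) _ lt'; set z := nth _ _ _ => zX.
  have -> : z == leaf v = false by apply: contraNF zX => /eqP->; apply: imset_f.
  have -> : z == y = false by apply: contraNF zX => /eqP->.
  by rewrite /= => h h'; rewrite h' in h.
pose le x y := ix x <= ix y; exists (sort le (enum (U :\ v))).
have mem_s : sort le (enum (U :\ v)) =i U :\ v by move=> x; rewrite mem_sort mem_enum.
split.
- by rewrite rcons_uniq mem_s !inE eqxx sort_uniq enum_uniq.
- by apply/setP=> x; rewrite !inE mem_rcons inE mem_s !inE; case: eqVneq => [->|].
have : all (mem (U :\ v)) (sort le (enum (U :\ v))) by apply/allP=> x; rewrite mem_s.
have : pairwise le (sort le (enum (U :\ v))).
  rewrite -sorted_pairwise; last by move=> a b c; apply: leq_trans.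
  by apply: sort_sorted => a b; apply: leq_total.
have : uniq (sort le (enum (U :\ v))) by rewrite sort_uniq enum_uniq.
elim: (sort le _) => //= x q IH /andP[xq uq] /andP[lx pq] /andP[xU aU].
rewrite IH // andbT; apply/allP=> y yq; apply/eqP.
move: xU (allP aU _ yq); rewrite /= !inE => /andP[xv xU] /andP[yv yU].
apply: lcaE => //; [by apply: contraNneq xq => -> | exact: (allP lx) | exact: ixv].
Qed.

End CatSideInv.

Section PolarCat.
Variables (T : finType) (e : rel T).
Hypothesis symE : symmetric e.
Implicit Types (U : {set T}) (s : seq T).

(** The chains of the two caterpillars are disjoint since [U1] and [U2] meet only in [v]; the cross
    constant tells the join from the disjoint union. *)
Lemma polar_cat_gall_seq U : polar_cat e U ->
  exists v s1 s2, [/\ gall_seq e U v s1 s2, s1 != [::] & s2 != [::]].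
Proof.
case=> v [U1 [U2 [[[defU defv] [U1gt U2gt] _ const] _ [_ [side1 side2]]]]].
have [vU1 vU2] : v \in U1 /\ v \in U2.
  by apply/andP; rewrite -in_setI defv set11.
have [W1 [E1 [l1 [t1 [ex1 _ cat1 ch1]]]]] := side1.
have [W2 [E2 [l2 [t2 [ex2 _ cat2 ch2]]]]] := side2.
have [s1 [us1 def1 pw1]] := caterpillar_chain vU1 ex1 cat1 ch1.
have [s2 [us2 def2 pw2]] := caterpillar_chain vU2 ex2 cat2 ch2.
have nonempty s V : V = [set x in rcons s v] -> 1 < #|V| -> s != [::].
  move=> ->; case: s => // /leq_trans/(_ (subset_leq_card (_ : _ \subset [set v]))).
  by rewrite cards1 => /(_ _)/negP; case=> //; apply/subsetP=> x; rewrite !inE.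
have disj x : x \in s1 -> x \in s2 -> False.
  move=> xs1 xs2; have : x \in U1 :&: U2.
    by rewrite def1 def2 !inE !mem_rcons !inE xs1 xs2 !orbT.
  by rewrite defv inE => /eqP xv; move: us1; rewrite rcons_uniq -xv xs1.
move: us1 us2; rewrite !rcons_uniq => /andP[vs1 us1] /andP[vs2 us2].
exists v, s1, s2; split; [split=> //|exact: nonempty def1 U1gt|exact: nonempty def2 U2gt].
- rewrite /= cat_uniq mem_cat negb_or vs1 vs2 us1 us2 /= andbT.
  by apply/hasPn=> x xs2; apply/negP=> /disj; apply.
- rewrite -defU def1 def2; apply/setP=> x; rewrite !inE !mem_rcons !inE mem_cat.
  by case: eqP => //=; rewrite ?orbT.
have inD x s V : V = [set x in rcons s v] -> x \in s -> v \notin s -> x \in V :\ v.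
  move=> -> xs vs; rewrite !inE mem_rcons inE xs orbT andbT.
  by apply: contraNneq vs => <-.
case: const => H; [exists true|exists false] => x y xs ys.
  by apply: H; [apply: inD def1 _ _ | apply: inD def2 _ _].
by apply/negbTE; apply: H; [apply: inD def1 _ _ | apply: inD def2 _ _].
Qed.

Lemma gall_seq_sym U v s1 s2 : gall_seq e U v s1 s2 -> gall_seq e U v s2 s1.
Proof.
case=> us -> pw1 pw2 [c H]; split=> //.
- move: us; rewrite /= !mem_cat orbC => /andP[-> us].
  by rewrite uniq_catC.
- by apply/setP=> x; rewrite !inE !mem_cat (orbC (x \in s1)).
by exists c => x y xs ys; rewrite symE H.
Qed.

Lemma prime_module_small U (X : {set T}) :
  prime_on e U -> X \subset U -> 1 < #|X| -> #|X| < #|U| ->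
  (forall x y z, x \in X -> y \in X -> z \in U -> z \notin X -> e x z = e y z) -> False.
Proof.
move=> [_ pr] sub X1 XU H; have M : module_in e U X by apply/module_inP.
by case: (pr _ M) => [|XeU]; [rewrite leqNgt X1 | rewrite XeU ltnn in XU].
Qed.

(** The vertices other than [a] would form a module. *)
Lemma prime_not_isolated U a c : prime_on e U -> a \in U ->
  (forall y, y \in U -> y != a -> e a y = c) -> False.
Proof.
move=> pr aU H; have U3 := pr.1; have cD := cardsD1 a U; rewrite aU in cD.
apply: (prime_module_small pr (subsetDl U [set a])); try lia.
move=> x y z; rewrite !inE => /andP[xa xU] /andP[ya yU] zU.
rewrite zU andbT negbK => /eqP->.
by rewrite ![e _ a]symE !H.
Qed.

Lemma pairwise_nth U v s1 s2 i j : gall_seq e U v s1 s2 -> i < j -> j < size s1 ->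
  e (nth v s1 i) (nth v s1 j) = e (nth v s1 i) v.
Proof.
case=> _ _ pw _ _ ij js; apply/eqP; apply: (pairwiseP v pw) => //.
by rewrite inE (ltn_trans ij).
Qed.

(** Otherwise the two neighbours on the chain form a module: an earlier vertex sees both as it sees
    [v], a later one is seen as [v] is, and the other side is constant. *)
Lemma prime_gall_alternates U v s1 s2 i : prime_on e U -> gall_seq e U v s1 s2 ->
  i.+1 < size s1 -> e (nth v s1 i) v != e (nth v s1 i.+1) v.
Proof.
move=> pr gs lt; apply/eqP=> eqv; have [us defU _ _ [c crossc]] := gs.
have [ui ui1] : nth v s1 i \in s1 /\ nth v s1 i.+1 \in s1.
  by rewrite !mem_nth // ltnW.
have us1 : uniq s1 by move: us; rewrite /= cat_uniq => /and4P[].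
set x := nth v s1 i in eqv ui *; set y := nth v s1 i.+1 in eqv ui1 *.
have xy : x != y by rewrite nth_uniq ?(ltnW lt) // neq_ltn leqnn.
have sub : [set x; y] \subset U.
  by apply/subsetP=> z /set2P[]->; rewrite defU !inE mem_cat ?ui ?ui1 orbT.
have same z : z \in U -> z \notin [set x; y] -> e x z = e y z.
  rewrite {1}defU !inE mem_cat negb_or => /or3P[/eqP->//|zs|zs] /andP[zx zy]; last first.
    by rewrite !crossc.
  have jlt : index z s1 < size s1 by rewrite index_mem.
  have [lt1|lt1|eq1] := ltngtP (index z s1) i.
  - have lt2 : index z s1 < i.+1 by rewrite ltnW.
    have h1 := pairwise_nth gs lt1 (ltnW lt); have h2 := pairwise_nth gs lt2 lt.
    by rewrite nth_index // in h1 h2; rewrite !(symE _ z) [LHS]h1 [RHS]h2.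
  - have [lt2|lt2|eq2] := ltngtP (index z s1) i.+1.
    + by move: lt2; rewrite ltnS leqNgt lt1.
    + have h1 := pairwise_nth gs lt1 jlt; have h2 := pairwise_nth gs lt2 jlt.
      by rewrite nth_index // in h1 h2; rewrite [LHS]h1 [RHS]h2.
    + by case/eqP: zy; rewrite /y -eq2 nth_index.
  - by case/eqP: zx; rewrite /x -eq1 nth_index.
apply: (prime_module_small pr sub); rewrite ?cards2 ?xy //; first exact: pr.1.
by move=> a b z /set2P[]-> /set2P[]-> zU zN; rewrite ?(same z zU zN).
Qed.

Lemma gall_head U v a s1 s2 y : gall_seq e U v (a :: s1) s2 ->
  y \in rcons s1 v -> e a y = e a v.
Proof.
case=> _ _ /= /andP[/allP H _] _ _; rewrite mem_rcons inE => /predU1P[->//|/H/eqP//].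
Qed.

(** With one side empty, the head of the other is adjacent to all vertices or to none. *)
Lemma prime_gall_nonempty U v s1 s2 : prime_on e U -> gall_seq e U v s1 s2 ->
  s1 != [::].
Proof.
move=> pr gs; apply/eqP=> s10; rewrite s10 in gs.
have [us defU _ _ _] := gs; case: s2 gs us defU => [|b s2] gs us defU.
  have := subset_leq_card (_ : U \subset [set v]); rewrite cards1 => /(_ _).
  have U3 := pr.1; rewrite leqNgt (ltn_trans _ U3) // => h.
  by suff /h : U \subset [set v]; rewrite // defU; apply/subsetP=> x; rewrite !inE.
apply: (@prime_not_isolated U b (e b v) pr); first by rewrite defU !inE eqxx orbT.
move=> y; rewrite defU !inE => + /negPf yb; rewrite yb /= => yin.
by apply: (gall_head (gall_seq_sym gs)); rewrite mem_rcons inE.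
Qed.

(** The head of the chain is universal or isolated in it, while every vertex of an induced path on
    four vertices has a neighbour and a non-neighbour in that path. So the path lies in the tail. *)
Lemma chain_cograph v s : pairwise (fun x y => e x y == e x v) s ->
  cograph e [set x in rcons s v].
Proof.
elim: s => [|a s IH] /=.
  move=> _ [x [y [z [w [[]]]]]]; rewrite !inE => /eqP-> /eqP-> _ _.
  by rewrite /= inE eqxx.
case/andP=> /allP Ha /IH{}IH [x [y [z [w [[xs ys zs ws] uP [xy yz zw] [xz yw xw]]]]]].
apply: IH; exists x, y, z, w; split=> //.
have {}Ha u : u \in rcons s v -> e a u = e a v.
  by rewrite mem_rcons inE => /predU1P[->//|/Ha/eqP].
have inS u : u \in [set x0 in a :: rcons s v] -> u != a -> u \in rcons s v.
  by rewrite !inE => /predU1P[->|//]; rewrite eqxx.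
have contra (b c : T) : b \in [set x0 in a :: rcons s v] -> c \in [set x0 in a :: rcons s v] ->
    b != a -> c != a -> e a b -> ~~ e a c -> False.
  move=> bS cS ba ca; have := inS _ bS ba; have := inS _ cS ca => cs bs.
  by rewrite !Ha // => ->.
move: uP; rewrite /= !inE !negb_or !andbT -!andbA.
case/and5P=> nxy nxz nxw nyz /andP[nyw nzw].
split; apply: inS => //; apply/eqP=> eqa; subst a.
- by apply: (contra y z); rewrite // eq_sym.
- by apply: (contra x w); rewrite // ?[e _ x]symE // eq_sym.
- by apply: (contra w x); rewrite // ?[e _ x]symE // eq_sym.
- by apply: (contra z y); rewrite // ?[e w _]symE // eq_sym.
Qed.

(** The head is uniform on its own side and sees the other side as [c]; if both values agreed it
    would be uniform on all of [U]. This is the source of the polarity. *)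
Lemma prime_gall_head U v a s1 s2 c : prime_on e U -> gall_seq e U v (a :: s1) s2 ->
  (forall x y, x \in a :: s1 -> y \in s2 -> e x y = c) -> e a v = ~~ c.
Proof.
move=> pr gs crossc; apply/eqP; have [us defU _ _ _] := gs.
suff : e a v != c by case: (e a v); case: (c).
apply/eqP=> eqc; apply: (@prime_not_isolated U a c pr).
  by rewrite defU !inE eqxx orbT.
move=> y; rewrite defU !inE mem_cat => + /negPf ya; rewrite ya /=.
case/or3P=> [/eqP->//|ys|ys]; last by apply: crossc; rewrite ?mem_head.
by rewrite -eqc; apply: (gall_head gs); rewrite mem_rcons inE ys orbT.
Qed.

Lemma chain_conn v a s : (forall y, y \in rcons s v -> e a y = true) ->
  connb e [set x in rcons (a :: s) v].
Proof.
move=> H; apply: (connb_hub (a := a)) => // x; rewrite inE /= inE => /predU1P[->//|xs].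
by apply: connect1; rewrite /restr /= !inE eqxx xs orbT H.
Qed.

Lemma chain_not_conn v a s : a \notin rcons s v ->
  (forall y, y \in rcons s v -> e a y = false) ->
  ~~ connb e [set x in rcons (a :: s) v].
Proof.
move=> as_ H; apply/negP=> co.
have aS : a \in [set x in rcons (a :: s) v] by rewrite !inE eqxx.
have vS : v \in [set x in rcons (a :: s) v] by rewrite !inE mem_rcons mem_head orbT.
have va : ~~ pred1 a v by apply: contraNN as_ => /eqP<-; rewrite mem_rcons mem_head.
have [x [y [_ yS /= /eqP-> ya]]] := connb_exit (P := pred1 a) co aS vS (eqxx a) va.
by move: yS ya; rewrite !inE => /predU1P[->|/H->//]; rewrite eqxx.
Qed.

Lemma prime_gall_polar_cat U v s1 s2 : prime_on e U -> gall_seq e U v s1 s2 ->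
  polar_cat e U.
Proof.
move=> pr gs; have gs' := gall_seq_sym gs.
have n1 := prime_gall_nonempty pr gs; have n2 := prime_gall_nonempty pr gs'.
have [us defU pw1 pw2 [c crossc]] := gs; have U3 := pr.1.
have [vs1 vs2 us1 us2 dis] : [/\ v \notin s1, v \notin s2, uniq s1, uniq s2 &
    forall x, x \in s1 -> x \notin s2].
  move: us; rewrite /= cat_uniq mem_cat negb_or => /and4P[/andP[-> ->] -> /hasPn h ->].
  by split=> // x xs; apply/negP=> /h; rewrite /= xs.
have cardS s : uniq s -> v \notin s -> #|[set x in rcons s v]| = (size s).+1.
  move=> u vs; rewrite cardsE; have /card_uniqP -> : uniq (rcons s v) by rewrite rcons_uniq vs.
  by rewrite size_rcons.
have inD s x : x \in [set x in rcons s v] :\ v -> x \in s.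
  by rewrite !inE mem_rcons inE => /andP[/negPf->].
have cardU : #|U| = (size s1 + size s2).+1.
  by rewrite defU cardsE; have /card_uniqP -> := us; rewrite /= size_cat.
have [p1 p2] : 0 < size s1 /\ 0 < size s2 by case: (s1) n1; case: (s2) n2.
exists v, [set x in rcons s1 v], [set x in rcons s2 v]; split.
- split; [split|split|split|].
  + by rewrite defU; apply/setP=> x; rewrite !inE !mem_rcons !inE mem_cat; case: eqP.
  + apply/setP=> x; rewrite !inE !mem_rcons !inE; case: eqP => //= _.
    by apply/negP=> /andP[/dis/negP].
  + by rewrite cardS.
  + by rewrite cardS.
  + exact: chain_cograph.
  + exact: chain_cograph.
  + by case: c crossc => crossc; [left|right] => x y /inD xs /inD ys; rewrite crossc.
- split=> //; case: s1 {cardU cardS p1} n1 gs gs' crossc us pw1 vs1 us1 dis defU => // a s1 _ gs gs' crossc us pw1 vs1 us1 dis defU.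
  case: s2 {p2} n2 gs gs' crossc us pw2 vs2 us2 dis defU => // b s2 _ gs gs' crossc us pw2 vs2 us2 dis defU.
  have ha := prime_gall_head pr gs crossc.
  have hb : e b v = ~~ c.
    by apply: (prime_gall_head pr gs') => x y xs ys; rewrite symE crossc.
  have hda y : y \in rcons s1 v -> e a y = ~~ c by move/(gall_head gs)->.
  have hdb y : y \in rcons s2 v -> e b y = ~~ c by move/(gall_head gs')->.
  have nin x s : v \notin x :: s -> uniq (x :: s) -> x \notin rcons s v.
    by rewrite mem_rcons !inE !negb_or eq_sym => /andP[-> _] /andP[].
  (* If the sides are joined, both heads are isolated in their sides; otherwise both are universal
     there. *)
  case: c {ha hb} hda hdb crossc => hda hdb crossc; [right|left]; split.
  + exact: chain_not_conn (nin _ _ vs1 us1) hda.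
  + split; first exact: chain_not_conn (nin _ _ vs2 us2) hdb.
    by move=> x y /inD xs /inD ys; rewrite crossc.
  + exact: chain_conn.
  + split; first exact: chain_conn.
    by move=> x y /inD xs /inD ys; rewrite crossc.
split; last first.
  split; apply: cat_side_chain => //; rewrite ?rcons_uniq ?vs1 ?vs2 //.
    by move=> i; apply: prime_gall_alternates gs.
  by move=> i; apply: prime_gall_alternates gs'.
(* With three vertices the sides are single vertices [a] and [b] that see [v] alike, and
   [[set a; b]] would be a module. *)
rewrite leqNgt; apply/negP=> U4.
case: s1 {cardS p1} n1 gs gs' crossc us vs1 cardU defU {pw1 us1 dis} => // a [|a' s1] _ gs gs' crossc us vs1 cardU defU; last first.
  by rewrite /= in cardU; lia.
case: s2 {p2} n2 gs gs' crossc us vs2 cardU defU {pw2 us2} => // b [|b' s2] _ gs gs' crossc us vs2 cardU defU; last first.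
  by rewrite /= in cardU; lia.
have ha := prime_gall_head pr gs crossc.
have hb : e b v = ~~ c.
  by apply: (prime_gall_head pr gs') => x y xs ys; rewrite symE crossc.
have ab : a != b by move: us; rewrite /= !inE !andbT => /andP[].
apply: (prime_module_small (X := [set a; b]) pr).
- by apply/subsetP=> x /set2P[]->; rewrite defU !inE eqxx ?orbT.
- by rewrite cards2 ab.
- by rewrite cards2 ab.
move=> x y z xX yX; rewrite defU !inE negb_or => /or3P[/eqP->|/eqP->|/eqP->];
  rewrite ?eqxx ?andbF // => _.
by case/set2P: xX => ->; case/set2P: yX => ->; rewrite ?ha ?hb.
Qed.

End PolarCat.

(** * Modules and quotients *)

Section Modules.
Variables (V : finType) (e : rel V).
Hypothesis symE : symmetric e.
Implicit Types (U S X A B : {set V}).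

(** Connectivity yields a crossing edge, co-connectivity a crossing non-edge; this refutes constant
    adjacency across any cut. *)
Lemma prime_cross U A c a b : connb e U -> connb (compl_rel e) U ->
  a \in U -> a \in A -> b \in U -> b \notin A ->
  exists x y, [/\ x \in U, y \in U, x \in A, y \notin A & e x y = c].
Proof.
move=> co coc aU aA bU bA; case: c.
  have [x [y [xU yU xA yA exy]]] := connb_exit (P := mem A) co aU bU aA bA.
  by exists x, y.
have [x [y [xU yU xA yA /andP[_ /negbTE exy]]]] :=
  connb_exit (P := mem A) coc aU bU aA bA.
by exists x, y.
Qed.

Lemma strong_inP U S :
  reflect (module_in e U S /\ forall S' x y z, module_in e U S' ->
             x \in S -> x \in S' -> y \in S -> y \notin S' -> z \in S' -> z \in S)
          (strong_in e U S).
Proof.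
apply: (iffP andP) => -[mS H]; split=> //.
  move=> S' x y z mS' xS xS' yS yS' zS'; move/forallP: H => /(_ S').
  rewrite mS' /= => /or3P[] /eqP/setP h.
  - by have := h y; rewrite inE yS (negPf yS').
  - by have := h z; rewrite inE zS' andbT => ->.
  - by have := h x; rewrite !inE xS xS'.
apply/forallP=> S'; apply/implyP=> mS'; apply/or3P.
have [sub|/subsetPn[y yS yS']] := boolP (S \subset S').
  by apply: Or31; apply/eqP/setIidPl.
have [->|/set0Pn[x]] := eqVneq (S :&: S') set0; first by apply: Or33.
case/setIP=> xS xS'; apply: Or32; apply/eqP/setIidPr/subsetP=> z.
by move=> zS'; apply: (H S' x y z).
Qed.

Lemma module_union U S S' x : module_in e U S -> module_in e U S' ->
  x \in S -> x \in S' -> module_in e U (S :|: S').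
Proof.
move=> /module_inP[sub H] /module_inP[sub' H'] xS xS'; apply/module_inP.
split=> [|a b z]; first by rewrite subUset sub.
have aux a' : a' \in S :|: S' -> z \in U -> z \notin S :|: S' -> e a' z = e x z.
  rewrite !inE negb_or => /orP[aS|aS] zU /andP[zS zS']; first exact: H.
  exact: H'.
by move=> aS bS zU zS; rewrite (aux a) // (aux b).
Qed.

(* A module overlapping a maximal one would, together with it, split U into two
   parts with constant adjacency. *)
Lemma maximal_module_strong U S : connb e U -> connb (compl_rel e) U ->
  maxset (fun S => module_in e U S && (S != U)) S -> strong_in e U S.
Proof.
move=> co coc /maxsetP[/andP[mS SU] mx]; apply/strong_inP; split=> //.
move=> S' x y z mS' xS xS' yS yS' zS'; apply/negPn/negP=> zS.
have [sub HS] := module_inP _ _ _ mS; have [sub' HS'] := module_inP _ _ _ mS'.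
have UU : S :|: S' = U.
  apply/eqP/negPn/negP=> nU; have := mx (S :|: S').
  rewrite nU (module_union mS mS' xS xS') subsetUl => /(_ isT isT) eqS.
  by move: zS; rewrite -eqS inE zS' orbT.
have outS w : w \in U -> w \notin S -> w \in S'.
  by rewrite -UU inE => /orP[->|].
have const u w : u \in S -> w \in U -> w \notin S -> e u w = e x y.
  move=> uS wU wS; rewrite (HS u y w) // symE.
  by apply: HS' => //; [apply: outS | apply: (subsetP sub)].
have [u [w [uU wU uS wS euw]]] :=
  prime_cross (~~ e x y) co coc (subsetP sub _ xS) xS (subsetP sub' _ zS') zS.
by have := const u w uS wU wS; rewrite euw; case: (e x y).
Qed.

Lemma MmaxP U S : S \in Mmax e U -> [/\ strong_in e U S, S != U &
  forall S', strong_in e U S' -> S' != U -> S \subset S' -> S' = S].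
Proof.
rewrite inE => /maxsetP[/andP[sS SU] mx]; split=> // S' sS' S'U.
by apply: mx; rewrite sS'.
Qed.

Lemma strong_module U S : strong_in e U S -> module_in e U S.
Proof. by case/andP. Qed.

Lemma Mmax_sub U S : S \in Mmax e U -> S \subset U.
Proof. by case/MmaxP=> /strong_module/andP[]. Qed.

Lemma Mmax_uniq U S S' x : S \in Mmax e U -> S' \in Mmax e U ->
  x \in S -> x \in S' -> S = S'.
Proof.
move=> /MmaxP[sS SU mxS] /MmaxP[sS' SU' mxS'] xS xS'.
have [sub|/subsetPn[y yS yS']] := boolP (S \subset S'); first by rewrite (mxS S').
apply: mxS' => //; apply/subsetP=> z zS'.
by have [_ H] := strong_inP _ _ sS; apply: (H S' x y z); rewrite ?strong_module.
Qed.

Lemma strong_set1 U x : x \in U -> strong_in e U [set x].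
Proof.
move=> xU; apply/strong_inP; split.
  by apply/module_inP; rewrite sub1set; split=> // a b z /set1P-> /set1P->.
by move=> S' a y z _ /set1P-> aS' /set1P->; rewrite aS'.
Qed.

Lemma Mmax_cover U X : strong_in e U X -> X != U ->
  exists2 S, S \in Mmax e U & X \subset S.
Proof.
move=> sX XU; have P : strong_in e U X && (X != U) by rewrite sX.
by have [S mxS sub] := maxset_exists (P := fun S => strong_in e U S && (S != U)) P;
  exists S; rewrite ?inE.
Qed.

Lemma Mmax_block U x : 1 < #|U| -> x \in U -> exists2 S, S \in Mmax e U & x \in S.
Proof.
move=> U1 xU; have [|S SM sub] := Mmax_cover (strong_set1 xU).
  by apply: contraTneq U1 => <-; rewrite cards1.
by exists S; rewrite // -sub1set.
Qed.

(** The empty set satisfies [strong_in], so it is maximality that excludes it: some block contains a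
    point. *)
Lemma Mmax_nonempty U S : 1 < #|U| -> S \in Mmax e U -> exists x, x \in S.
Proof.
move=> U1 SM; apply/set0Pn/eqP=> S0.
have /card_gt0P[x xU] : 0 < #|U| by apply: ltnW.
have [S' S'M xS'] := Mmax_block U1 xU; have [sS' S'U _] := MmaxP S'M.
have [_ _ mx] := MmaxP SM; have eqS := mx S' sS' S'U.
by move: xS'; rewrite eqS S0 ?sub0set // inE.
Qed.

Lemma Mmax_module U X : connb e U -> connb (compl_rel e) U ->
  module_in e U X -> X != U -> exists2 S, S \in Mmax e U & X \subset S.
Proof.
move=> co coc mX XU; have P : module_in e U X && (X != U) by rewrite mX.
have [S mxS sub] := maxset_exists (P := fun S => module_in e U S && (S != U)) P.
have /maxsetP[/andP[_ SU] _] := mxS.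
have [S' S'M sub'] := Mmax_cover (maximal_module_strong co coc mxS) SU.
by exists S'; rewrite // (subset_trans sub).
Qed.

Lemma quot_rel_edge U S S' x y : S \in Mmax e U -> S' \in Mmax e U -> S != S' ->
  x \in S -> y \in S' -> quot_rel e S S' = e x y.
Proof.
move=> SM S'M SS' xS yS'; rewrite /quot_rel /= SS' /=.
have [sS _ _] := MmaxP SM; have [sS' _ _] := MmaxP S'M.
have [sub H] := module_inP _ _ _ (strong_module sS).
have [sub' H'] := module_inP _ _ _ (strong_module sS').
have out a b : a \in S -> b \in S' -> b \notin S.
  move=> aS bS'; apply: contraNN SS' => bS.
  by apply/eqP; apply: Mmax_uniq SM S'M bS bS'.
have const a b : a \in S -> b \in S' -> e a b = e x y.
  move=> aS bS'; rewrite (H a x b) // ?(subsetP sub') ?(out a) //.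
  rewrite [LHS]symE [RHS]symE (H' b y x) ?(subsetP sub) //.
  apply: contraNN SS' => xS'.
  by apply/eqP; apply: Mmax_uniq SM S'M xS xS'.
apply/forall_inP/idP=> [/(_ x xS)/forall_inP/(_ y yS')//|exy a aS].
by apply/forall_inP=> b bS'; rewrite const.
Qed.

Lemma quot_sym : symmetric (quot_rel e).
Proof.
move=> A B; rewrite /quot_rel /= eq_sym; congr (_ && _).
by apply/forall_inP/forall_inP=> H x xA; apply/forall_inP=> y yB; rewrite symE;
  move/forall_inP: (H y yB); apply.
Qed.

(** The union of a proper module of the quotient is a proper module of [U], hence lies in one block.
    Two blocks alone would be a cut with constant adjacency. *)
Lemma prime_quotient U : connb e U -> connb (compl_rel e) U -> 1 < #|U| ->
  prime_on (quot_rel e) (Mmax e U).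
Proof.
move=> co coc U1; split.
  rewrite ltnNge; apply/negP=> le2; have /card_gt0P[x xU] := ltnW U1.
  have [S SM xS] := Mmax_block U1 xU.
  have [sS SU _] := MmaxP SM; have subS := Mmax_sub SM.
  have /subsetPn[y yU yS] : ~~ (U \subset S) by apply: contra SU; rewrite eqEsubset subS.
  have [S' S'M yS'] := Mmax_block U1 yU.
  have SS' : S != S' by apply: contraNneq yS => ->.
  have cover z : z \in U -> z \notin S -> z \in S'.
    move=> zU zS; have [S3 S3M zS3] := Mmax_block U1 zU.
    have [<-//|n] := eqVneq S3 S'; case/negP: zS.
    suff -> : S = S3 by []; apply/eqP/negPn/negP=> n'; move: le2; rewrite leqNgt; case/negP.
    have sub : [set S; S'; S3] \subset Mmax e U.
      by apply/subsetP=> A; rewrite !inE => /orP[/orP[]|] /eqP->; rewrite -?in_set.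
    apply: leq_trans (subset_leq_card sub).
    by rewrite setUC cardsU1 cards2 !inE SS' eq_sym (negPf n') (negPf n).
  have [u [w [uU wU uS wS euw]]] := prime_cross (~~ quot_rel e S S') co coc xU xS yU yS.
  have := quot_rel_edge SM S'M SS' uS (cover w wU wS).
  by rewrite euw; case: (quot_rel _ _ _).
move=> X /module_inP[subX HX]; have [|XM] := eqVneq X (Mmax e U); [by right|left].
have coverP x : reflect (exists2 S, S \in X & x \in S) (x \in cover X).
  exact: bigcupP.
have mX : module_in e U (cover X).
  apply/module_inP; split.
    apply/subsetP=> x /coverP[S SX xS].
    exact: subsetP (Mmax_sub (subsetP subX _ SX)) _ xS.
  move=> a b z /coverP[A AX aA] /coverP[B BX bB] zU zX.
  have [C CM zC] := Mmax_block U1 zU.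
  have CX : C \notin X by apply: contraNN zX => CX; apply/coverP; exists C.
  have [AM BM] := (subsetP subX _ AX, subsetP subX _ BX).
  have AC : A != C by apply: contraNneq CX => <-.
  have BC : B != C by apply: contraNneq CX => <-.
  by rewrite -(quot_rel_edge AM CM AC aA zC) -(quot_rel_edge BM CM BC bB zC); apply: HX.
have nU : cover X != U.
  have /subsetPn[S SM SX] : ~~ (Mmax e U \subset X) by apply: contra XM; rewrite eqEsubset subX.
  have [x xS] := Mmax_nonempty U1 SM.
  apply/eqP=> eqU; have /coverP[S' S'X xS'] : x \in cover X.
    by rewrite eqU (subsetP (Mmax_sub SM)).
  by case/negP: SX; rewrite (Mmax_uniq SM (subsetP subX _ S'X) xS xS').
have [S SM sub] := Mmax_module co coc mX nU.
apply/card_le1_eqP; suff H A : A \in X -> A = S by move=> A B /H-> /H->.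
move=> AX; have AM := subsetP subX _ AX; have [x xA] := Mmax_nonempty U1 AM.
by apply: (Mmax_uniq AM SM xA); apply: (subsetP sub); apply/coverP; exists A.
Qed.

End Modules.

(** * From explaining networks to polar-cat quotients *)

Section NetworkFacts.
Variables (W : finType) (E : rel W).
Hypothesis acE : acyclic E.

Lemma acyclic_root_connect r : (forall v, v != r -> 0 < indeg E v) ->
  forall v, connect E r v.
Proof.
move=> par v; have [m] := ubnP #|[set u | connect E u v]|.
elim: m v => // m IH v ltm; have [->|vr] := eqVneq v r; first exact: connect0.
have /card_gt0P[p] := par v vr; rewrite inE => Ep.
apply: connect_trans (connect1 Ep); apply: IH; rewrite -ltnS (leq_trans _ ltm) // ltnS.
apply: proper_card; apply/properP; split.
  by apply/subsetP=> u; rewrite !inE => /connect_trans; apply; apply: connect1.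
by exists v; rewrite !inE ?connect0 //; apply: acE.
Qed.

(** Passes from maximal biconnected sets to arbitrary ones, such as the cycles built above. *)
Lemma level1_hybrid_uniq (B : {set W}) h h' :
  (forall v, 1 < indeg E v -> hybridb E v) -> level1 E -> biconnb (und E) B ->
  1 < indeg E h -> 1 < indeg E h' -> h \in B -> h' \in B -> h = h'.
Proof.
move=> hyb lvl bB hh hh' hB h'B.
have [B' mxB' sub] := maxset_exists bB.
by apply: (card_le1_eqP (lvl _ mxB')); rewrite inE ?(subsetP sub) // hyb.
Qed.

End NetworkFacts.

(** The quotient is read in the given network itself, a block standing for the leaf of its
    representative. *)
Lemma explainable_PolarCat_prime (V : finType) (e : rel V) :
  symmetric e -> L1_explainable e -> PolarCat_prime e.
Proof.
move=> symE [W [E [leaf [t [[acE net] injl lvl _ expl]]]]] M /and3P[_ co coc] M1.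
case: net => [[W1 _]|[[r [rin _ _ inner]] leafP]].
  by have := leq_trans M1 (leq_trans (max_card _) (leq_card leaf injl)); rewrite W1.
have degE v : v != r -> 0 < indeg E v <= 2 /\ (1 < indeg E v -> hybridb E v).
  move=> vr; have [/leafP[_ ->]//|vX] := boolP (v \in leaf @: [set: V]).
  case: (inner v vX vr) => [/andP[/eqP->]//|h].
  by case/andP: (h) => /eqP->.
have deg2 v : indeg E v <= 2.
  by have [->|/degE[/andP[]]//] := eqVneq v r; rewrite rin.
have hyb v : 1 < indeg E v -> hybridb E v.
  by have [->|/degE[]//] := eqVneq v r; rewrite rin.
have rootE : forall v, connect E r v.
  by apply: acyclic_root_connect => // v /degE[/andP[]].
have [x0 x0M] : exists x, x \in M by apply/card_gt0P; apply: ltnW.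
(* The default [x0] only makes [rep] total; blocks are nonempty. *)
pose rep (S : {set V}) := odflt x0 [pick x in S].
have repP S : S \in Mmax e M -> rep S \in S.
  move=> SM; rewrite /rep; case: pickP => // none.
  by have [x xS] := Mmax_nonempty M1 SM; have := none x; rewrite /= xS.
have pr := prime_quotient symE co coc M1.
have edge S S' : S \in Mmax e M -> S' \in Mmax e M -> S != S' ->
    quot_rel e S S' = e (rep S) (rep S').
  by move=> SM S'M SS'; apply: (quot_rel_edge symE SM S'M SS'); apply: repP.
have rep_neq S S' : S \in Mmax e M -> S' \in Mmax e M -> S != S' -> rep S != rep S'.
  move=> SM S'M; apply: contraNneq => eqr; apply/eqP.
  by apply: (Mmax_uniq SM S'M (repP _ SM)); rewrite eqr repP.
have lcaE A B A' B' : A \in Mmax e M -> B \in Mmax e M -> A' \in Mmax e M ->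
    B' \in Mmax e M -> A != B -> A' != B' ->
    (forall w, connect E w (leaf (rep A)) && connect E w (leaf (rep B)) =
               connect E w (leaf (rep A')) && connect E w (leaf (rep B'))) ->
    quot_rel e A B = quot_rel e A' B'.
  move=> AM BM A'M B'M AB A'B' eqc; rewrite !edge //; apply/idP/idP.
    move/(expl _ _ (rep_neq _ _ AM BM AB)) => [w [lw tw]].
    by apply/(expl _ _ (rep_neq _ _ A'M B'M A'B')); exists w; split=> //; apply: is_lca_eq lw.
  move/(expl _ _ (rep_neq _ _ A'M B'M A'B')) => [w [lw tw]].
  by apply/(expl _ _ (rep_neq _ _ AM BM AB)); exists w; split=> //; apply: is_lca_eq lw.
have [v [s1 [s2 gs]]] := prime_network_gall_seq acE rootE
  (fun B h h' => level1_hybrid_uniq (h := h) (h' := h') hyb lvl) deg2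
  (quot_sym symE) (leaf := fun S => leaf (rep S)) lcaE pr.
exact: (prime_gall_polar_cat (quot_sym symE) pr gs).
Qed.

(** * Composition of networks *)

Lemma homo_connect (T T' : finType) (R : rel T) (R' : rel T') (f : T -> T') :
  {homo f : x y / R x y >-> R' x y} ->
  {homo f : x y / connect R x y >-> connect R' x y}.
Proof.
move=> H x y /connectP[p pth ->]; elim: p x pth => [|z p IH] x /=; first by rewrite connect0.
by case/andP=> /H/connect1 xz /IH; apply: connect_trans.
Qed.

Record net (V : finType) := Net {
  net_vertex : finType;
  net_edge : rel net_vertex;
  net_root : net_vertex;
  net_leaf : V -> net_vertex;
  net_label : net_vertex -> label
}.

(* A cut vertex [c] between [h] and [h'], with the side [S] of the cut that does
   not contain the root. *)
Definition separated_by_cut (W : finType) (E : rel W) (r h h' : W) :=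
  exists c (S : {set W}),
    [/\ c != h, c != h', (r \notin S) && (c \notin S), (h \in S) != (h' \in S) &
        forall a b, a \in S -> b \notin S -> b != c -> ~~ und E a b].

(** A form of [is_network] and [level1] suited to gluing: the root is explicit, a single vertex that
    is both root and leaf is allowed, and [net_cut] stands in for the condition on biconnected
    sets. *)
Record level1_net (W : finType) (E : rel W) (X : {set W}) (r : W) : Prop := {
  net_acyclic : acyclic E;
  net_root_connect : forall v, connect E r v;
  net_root_indeg : indeg E r = 0;
  net_inner_indeg : forall v, v != r -> indeg E v = 1 \/ (indeg E v = 2 /\ v \notin X);
  net_leaf_outdeg : forall v, (v \in X) = (outdeg E v == 0);
  net_inner_outdeg : forall v, v \notin X -> indeg E v <= 1 -> 2 <= outdeg E v;
  net_cut : forall h h', h != h' -> 1 < indeg E h -> 1 < indeg E h' ->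
     separated_by_cut E r h h'
}.

Definition net_explains (V : finType) (e : rel V) (U : {set V}) (N : net V) :=
  let E := @net_edge V N in let leaf := @net_leaf V N in let t := @net_label V N in
  [/\ level1_net E (leaf @: U) (net_root N), {in U &, injective leaf}, labeling (leaf @: U) t &
      forall x y, x \in U -> y \in U -> x != y ->
        (e x y <-> exists w, is_lca E (leaf x) (leaf y) w /\ t w = L1)].

Definition explained (V : finType) (e : rel V) (U : {set V}) := exists N, net_explains e U N.

Section Composition.
Variables (V : finType) (e : rel V) (U : {set V}) (I : finType) (part : V -> I).
Let P i := [set x in U | part x == i].
Variables (W0 : finType) (E0 : rel W0) (r0 : W0) (att : I -> W0) (t0 : W0 -> label).
Hypothesis acE0 : acyclic E0.
Hypothesis root0 : forall v, connect E0 r0 v.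
Hypothesis indeg_root0 : indeg E0 r0 = 0.
Hypothesis indeg0 : forall v, v != r0 -> indeg E0 v = 1 \/ indeg E0 v = 2.
Hypothesis hybrid0 : forall h h', 1 < indeg E0 h -> 1 < indeg E0 h' -> h = h'.
Hypothesis outdeg0 : forall v,
  (if indeg E0 v <= 1 then 2 else 1) <= outdeg E0 v + #|[set i | att i == v]|.
Hypothesis label0 : forall v, t0 v <> Lodot.
Hypothesis lca0 : forall x y, x \in U -> y \in U -> part x != part y ->
  (e x y <-> exists w, is_lca E0 (att (part x)) (att (part y)) w /\ t0 w = L1).
Variable N : I -> net V.
Hypothesis explN : forall i, net_explains e (P i) (N i).

Let W i := net_vertex (N i).
Let E i : rel (W i) := @net_edge V (N i).
Let r i : W i := net_root (N i).
Let leaf i : V -> W i := @net_leaf V (N i).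
Let t i : W i -> label := @net_label V (N i).

Let explNE i : [/\ level1_net (@E i) (@leaf i @: P i) (r i), {in P i &, injective (@leaf i)},
  labeling (@leaf i @: P i) (@t i) &
      forall x y, x \in P i -> y \in P i -> x != y ->
        (e x y <-> exists w, is_lca (@E i) (leaf i x) (leaf i y) w /\ t w = L1)].
Proof. exact: explN. Qed.

Let netN i : level1_net (@E i) (@leaf i @: P i) (r i).
Proof. by case: (explNE i). Qed.

Let Wc := (W0 + {i : I & W i})%type.
Definition part_vertex i (a : W i) : Wc := inr (Tagged W a).

(** The root of the network of part [i] becomes a child of [att i] in the base digraph, and no edge
    returns to the base. [outdeg0] accordingly counts attached parts as children. *)
Definition comp_edge : rel Wc := fun u v =>
  match u, v with
  | inl a, inl b => E0 a b
  | inl a, inr y => (att (tag y) == a) && (tagged y == r (tag y))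
  | inr x, inr y => (tag x == tag y) && E (tagged x) (tagged_as x y)
  | inr _, inl _ => false
  end.

Definition comp_reach : rel Wc := fun u v =>
  match u, v with
  | inl a, inl b => connect E0 a b
  | inl a, inr y => connect E0 a (att (tag y))
  | inr x, inr y => (tag x == tag y) && connect (@E (tag x)) (tagged x) (tagged_as x y)
  | inr _, inl _ => false
  end.

Lemma comp_ind (Q : Wc -> Prop) :
  (forall a, Q (inl a)) -> (forall i a, Q (@part_vertex i a)) -> forall u, Q u.
Proof. by move=> h1 h2 [a|[i a]] //; apply: h2. Qed.

Lemma comp_edge_part i (a b : W i) :
  comp_edge (part_vertex a) (part_vertex b) = E a b.
Proof. by rewrite /= eqxx tagged_asE. Qed.

Lemma comp_edge_parts i j (a : W i) (b : W j) :
  comp_edge (part_vertex a) (part_vertex b) -> i = j.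
Proof. by case/andP=> /eqP. Qed.

Lemma comp_reach_part i (a b : W i) :
  comp_reach (part_vertex a) (part_vertex b) = connect (@E i) a b.
Proof. by rewrite /= eqxx tagged_asE. Qed.

Lemma comp_connectE : connect comp_edge =2 comp_reach.
Proof.
have step u v w : comp_edge u v -> comp_reach v w -> comp_reach u w.
  elim/comp_ind: u => [a|i a]; elim/comp_ind: v => [b|j b]; elim/comp_ind: w => [c|k c] //.
  - by move=> /= /connect1; apply: connect_trans.
  - by move=> /= /connect1; apply: connect_trans.
  - by move=> /= /andP[/eqP<- _] /andP[/eqP jk _]; rewrite jk connect0.
  - move=> Eij; have eqij := comp_edge_parts Eij; subst j.
    move=> R; have eqik : i = k by case/andP: R => /eqP.
    subst k; move: Eij R; rewrite comp_edge_part !comp_reach_part => /connect1.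
    exact: connect_trans.
have refl u : comp_reach u u.
  by elim/comp_ind: u => [a|i a]; rewrite ?comp_reach_part ?connect0 //= connect0.
move=> u w; apply/idP/idP=> [/connectP[p pth ->]|].
  by elim: p u pth => //= v p IH u /andP[Euv /IH]; apply: step.
elim/comp_ind: u => [a|i a]; elim/comp_ind: w => [c|k c] //.
- by apply: (homo_connect (f := inl)).
- move=> ac; apply: (@connect_trans _ _ (inl (att k))).
    by move: ac; apply: (homo_connect (f := inl)).
  apply: (@connect_trans _ _ (part_vertex (r k))).
    by apply: connect1; rewrite /= !eqxx.
  apply: (homo_connect (R := @E k) (f := @part_vertex k)); last exact: (net_root_connect (netN k)).
  by move=> x y; rewrite comp_edge_part.
move=> R; have eqik : i = k by case/andP: R => /eqP.
subst k; move: R; rewrite comp_reach_part.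
by apply: (homo_connect (f := @part_vertex i)) => x y; rewrite comp_edge_part.
Qed.

Lemma comp_acyclic : acyclic comp_edge.
Proof.
move=> u v; rewrite comp_connectE.
elim/comp_ind: u => [a|i a]; elim/comp_ind: v => [b|j b] //; first exact: acE0.
move=> Eij; have eqij := comp_edge_parts Eij; subst j.
by move: Eij; rewrite comp_edge_part comp_reach_part; apply: (net_acyclic (netN i)).
Qed.

Lemma part_vertex_inj i : injective (@part_vertex i).
Proof.
move=> a b /eqP; rewrite /part_vertex => /eqP[] /eqP.
by rewrite -/(Tagged W a) -/(Tagged W b) eq_Tagged => /eqP.
Qed.

Lemma comp_indeg_base b : indeg comp_edge (inl b) = indeg E0 b.
Proof.
transitivity #|[set (inl a : Wc) | a in [set a | E0 a b]]|; last exact: (card_imset _ (@inl_inj _ _)).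
apply: eq_card => u; rewrite [LHS]inE; apply/idP/imsetP=> [|[a + ->]]; last by rewrite inE.
by case: u => [a|//] Eab; exists a; rewrite ?inE.
Qed.

Lemma comp_indeg_root i : indeg comp_edge (part_vertex (r i)) = 1.
Proof.
rewrite -(cards1 (inl (att i) : Wc)); apply: eq_card => u; rewrite !inE.
 elim/comp_ind: u => [a|j a].
  by rewrite /= eqxx andbT eq_sym.
apply/negbTE/negP=> Eji; have eqji := comp_edge_parts Eji; subst j.
move: Eji; rewrite comp_edge_part => Eai.
have := net_root_indeg (netN i) => /eqP; rewrite cards_eq0 => /eqP/setP/(_ a).
by rewrite !inE Eai.
Qed.

Lemma comp_indeg_part i (b : W i) : b != r i ->
  indeg comp_edge (part_vertex b) = indeg (@E i) b.
Proof.
move=> br; transitivity #|@part_vertex i @: [set a | E a b]|; last exact: (card_imset _ (@part_vertex_inj i)).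
apply: eq_card => u; rewrite [LHS]inE; apply/idP/imsetP=> [|[a + ->]]; last first.
  by rewrite inE comp_edge_part.
elim/comp_ind: u => [a /= /andP[_]|j a Eji]; first by rewrite (negPf br).
have eqji := comp_edge_parts Eji; subst j; move: Eji; rewrite comp_edge_part => Eab.
by exists a; rewrite ?inE.
Qed.

Lemma comp_outdeg_part i (a : W i) :
  outdeg comp_edge (part_vertex a) = outdeg (@E i) a.
Proof.
transitivity #|@part_vertex i @: [set b | E a b]|; last exact: (card_imset _ (@part_vertex_inj i)).
apply: eq_card => u; rewrite [LHS]inE; apply/idP/imsetP=> [|[b + ->]]; last first.
  by rewrite inE comp_edge_part.
elim/comp_ind: u => [//|j b Eij].
have eqij := comp_edge_parts Eij; subst j; move: Eij; rewrite comp_edge_part => Eab.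
by exists b; rewrite ?inE.
Qed.

Lemma comp_outdeg_base a :
  outdeg comp_edge (inl a) = outdeg E0 a + #|[set i | att i == a]|.
Proof.
pose f i : Wc := part_vertex (r i).
have injf : injective f by move=> i j [].
have -> : outdeg E0 a = #|[set (inl b : Wc) | b in [set b | E0 a b]]|.
  by rewrite (card_imset _ (@inl_inj _ _)).
rewrite -(card_imset _ injf).
rewrite -cardsUI [X in _ + #|pred_of_set X|](_ : _ = set0) ?cards0 ?addn0; last first.
  by apply/setP=> u; rewrite !inE; apply/negbTE/negP=> /andP[/imsetP[b _ ->] /imsetP[i]].
apply: eq_card => u; rewrite !inE.
apply/idP/orP=> [|[/imsetP[b + ->]|/imsetP[i + ->]]]; last 2 first.
- by rewrite inE.
- by rewrite inE /= eqxx andbT.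
elim/comp_ind: u => [b Eab|i b /= /andP[ai /eqP->]]; [left|right].
  by apply/imsetP; exists b; rewrite ?inE.
by apply/imsetP; exists i; rewrite ?inE.
Qed.

Definition comp_leaf x : Wc := part_vertex (leaf (part x) x).

Lemma comp_leaf_part i (a : W i) :
  (part_vertex a \in comp_leaf @: U) = (a \in @leaf i @: P i).
Proof.
apply/imsetP/imsetP=> [[x xU]|[x]]; last first.
  by rewrite inE => /andP[xU /eqP xi] ->; exists x => //; subst i.
rewrite /comp_leaf => eqa; have eqi : i = part x by case: eqa.
subst i; move/part_vertex_inj: eqa => ->.
by exists x; rewrite // inE xU eqxx.
Qed.

Lemma comp_leaf_base a : (inl a \in comp_leaf @: U) = false.
Proof. by apply/negbTE/negP=> /imsetP[]. Qed.

(** The root of part [i] is the cut vertex: it has indegree one and carries the only edge into the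
    part. *)
Lemma comp_cut_part i (a : W i) u : 1 < indeg comp_edge (part_vertex a) ->
  1 < indeg comp_edge u -> (forall b : W i, u != part_vertex b) ->
  exists c (S : {set Wc}),
    [/\ c != part_vertex a, c != u, (inl r0 \notin S) && (c \notin S),
        (part_vertex a \in S) && (u \notin S) &
        forall x y, x \in S -> y \notin S -> y != c -> ~~ und comp_edge x y].
Proof.
move=> ha hu nu; exists (part_vertex (r i)), (@part_vertex i @: [set b | b != r i]).
have ar : a != r i by apply: contraTneq ha => ->; rewrite comp_indeg_root.
split.
- by rewrite eq_sym (inj_eq (@part_vertex_inj i)).
- by rewrite eq_sym.
- apply/andP; split; apply/negP=> /imsetP[b] //.
  by rewrite inE => br /part_vertex_inj eqb; rewrite eqb eqxx in br.
- rewrite (mem_imset _ _ (@part_vertex_inj i)) inE ar /=.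
  by apply/negP=> /imsetP[b _ eqb]; have := nu b; rewrite eqb eqxx.
move=> x y /imsetP[b + ->]; rewrite inE => br.
elim/comp_ind: y => [c _ _|j c yS yr].
  by rewrite /und /= (negPf br) andbF.
have [eqij|nij] := eqVneq i j; last first.
  by apply/negP=> /orP[] /comp_edge_parts eqij; rewrite eqij eqxx in nij.
subst j; case/negP: yS; rewrite (mem_imset _ _ (@part_vertex_inj i)) inE.
by rewrite (inj_eq (@part_vertex_inj i)) in yr.
Qed.

(** The base has at most one hybrid. Two hybrids of one part keep their old cut, whose side avoids
    the root of the part and so does not touch the new edge from the base. *)
Lemma comp_cut h h' : h != h' -> 1 < indeg comp_edge h -> 1 < indeg comp_edge h' ->
  separated_by_cut comp_edge (inl r0) h h'.
Proof.
elim/comp_ind: h => [a|i a]; elim/comp_ind: h' => [b|j b] nhh' hh hh'.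
- rewrite !comp_indeg_base in hh hh'.
  by case/eqP: nhh'; rewrite (hybrid0 hh hh').
- have [c [S [ca cb cS /andP[bS aS] H]]] : exists c (S : {set Wc}), _ :=
    comp_cut_part hh' hh (fun _ => isT).
  by exists c, S; split=> //; rewrite bS (negPf aS).
- have [c [S [ca cb cS /andP[aS bS] H]]] : exists c (S : {set Wc}), _ :=
    comp_cut_part hh hh' (fun _ => isT).
  by exists c, S; split=> //; rewrite aS (negPf bS).
have [eqij|nij] := eqVneq i j; last first.
  have nb (c : W i) : part_vertex b != part_vertex c.
    by apply: contraNneq nij => eqbc; apply/eqP; case: eqbc.
  have [c [S [ca cb cS /andP[aS bS] H]]] := comp_cut_part hh hh' nb.
  by exists c, S; split=> //; rewrite aS (negPf bS).
subst j; rewrite (inj_eq (@part_vertex_inj i)) in nhh'.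
have ar : a != r i by apply: contraTneq hh => ->; rewrite comp_indeg_root.
have br : b != r i by apply: contraTneq hh' => ->; rewrite comp_indeg_root.
rewrite !comp_indeg_part // in hh hh'.
have [c [S [ca cb /andP[rS cS] abS H]]] := net_cut (netN i) nhh' hh hh'.
have memS (x : W i) : (part_vertex x \in @part_vertex i @: S) = (x \in S).
  by rewrite (mem_imset _ _ (@part_vertex_inj i)).
exists (part_vertex c), (@part_vertex i @: S); rewrite !(inj_eq (@part_vertex_inj i)) !memS.
split=> //; first by rewrite cS andbT; apply/negP=> /imsetP[].
move=> x y /imsetP[z zS ->]; elim/comp_ind: y => [d _ _|j d].
  rewrite /und /= negb_and; apply/orP; right.
  by apply: contraNneq rS => <-.
have [eqij|nij] := eqVneq i j; last first.
  by move=> _ _; apply/negP=> /orP[] /comp_edge_parts eqij; rewrite eqij eqxx in nij.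
subst j; rewrite memS (inj_eq (@part_vertex_inj i)) => dS dc.
have := H z d zS dS dc; rewrite !negb_or => /andP[nzd ndz].
by rewrite !comp_edge_part nzd.
Qed.

Lemma comp_level1_net : level1_net comp_edge (comp_leaf @: U) (inl r0).
Proof.
split.
- exact: comp_acyclic.
- by move=> u; rewrite comp_connectE; elim/comp_ind: u => [a|i a] /=; apply: root0.
- by rewrite comp_indeg_base.
- elim/comp_ind=> [a ar|i a _].
    by rewrite comp_indeg_base comp_leaf_base; case: (indeg0 ar); [left|right].
  have [->|ar] := eqVneq a (r i); first by left; apply: comp_indeg_root.
  rewrite comp_indeg_part // comp_leaf_part.
  exact: (net_inner_indeg (netN i)).
- elim/comp_ind=> [a|i a].
    rewrite comp_leaf_base comp_outdeg_base; apply/esym/negbTE; rewrite -lt0n.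
    by apply: leq_trans (outdeg0 a); case: ifP.
  by rewrite comp_leaf_part comp_outdeg_part (net_leaf_outdeg (netN i)).
- elim/comp_ind=> [a _|i a].
    by rewrite comp_indeg_base comp_outdeg_base => h; have := outdeg0 a; rewrite h.
  rewrite comp_leaf_part comp_outdeg_part => aX h; apply: (net_inner_outdeg (netN i)) => //.
  have [->|ar] := eqVneq a (r i); first by rewrite (net_root_indeg (netN i)).
  by rewrite comp_indeg_part in h.
exact: comp_cut.
Qed.

Definition comp_label (u : Wc) : label :=
  match u with inl a => t0 a | inr x => t (tagged x) end.

(** A base vertex above the part is not minimal, since the root of the part is already a common
    ancestor. *)
Lemma comp_lca_part i (a b : W i) u :
  is_lca comp_edge (part_vertex a) (part_vertex b) u <->
  exists2 w, u = part_vertex w & is_lca (@E i) a b w.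
Proof.
split=> [[ua ub mn]|[w -> [wa wb mn]]].
  move: ua ub mn; rewrite !comp_connectE; elim/comp_ind: u => [c|j c] ca cb mn.
    have rE (w : W i) : connect comp_edge (part_vertex (r i)) (part_vertex w).
      by rewrite comp_connectE comp_reach_part; apply: (net_root_connect (netN i)).
    by have := mn _ (rE a) (rE b); rewrite comp_connectE => /(_ ca).
  have eqij : j = i by case/andP: ca => /eqP.
  subst j; exists c => //; rewrite !comp_reach_part in ca cb.
  split=> // w wa wb cw; apply: part_vertex_inj; apply: mn; rewrite comp_connectE comp_reach_part //.
split; rewrite ?comp_connectE ?comp_reach_part // => u'.
rewrite !comp_connectE; elim/comp_ind: u' => [//|j c] ca cb wc.
have eqij : j = i by case/andP: ca => /eqP.
subst j; rewrite !comp_reach_part in ca cb wc.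
by rewrite (mn c).
Qed.

Lemma comp_lca_parts i j (a : W i) (b : W j) u : i != j ->
  is_lca comp_edge (part_vertex a) (part_vertex b) u <->
  exists2 w, u = inl w & is_lca E0 (att i) (att j) w.
Proof.
move=> nij; split=> [[ua ub mn]|[w -> [wa wb mn]]].
  move: ua ub mn; rewrite !comp_connectE; elim/comp_ind: u => [c|k c] ca cb mn.
    exists c => //; split=> // w wa wb cw.
    by have [] : inl w = inl c :> Wc; first by apply: mn; rewrite comp_connectE.
  case/andP: ca cb => /eqP /= eqki _ /andP[/eqP /= eqkj _].
  by rewrite -eqki eqkj eqxx in nij.
split; rewrite ?comp_connectE // => u'.
rewrite !comp_connectE; elim/comp_ind: u' => [c|k c] ca cb wc; first by rewrite (mn c).
case/andP: ca cb => /eqP /= eqki _ /andP[/eqP /= eqkj _].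
by rewrite -eqki eqkj eqxx in nij.
Qed.

Lemma comp_explained : explained e U.
Proof.
exists (Net comp_edge (inl r0) comp_leaf comp_label); rewrite /net_explains /=; split.
- exact: comp_level1_net.
- move=> x y xU yU; rewrite /comp_leaf => eqxy; have eqp : part x = part y by case: eqxy.
  have [_ inj _ _] := explNE (part x); apply: inj.
  + by rewrite inE xU eqxx.
  + by rewrite inE yU eqp eqxx.
  by move: eqxy; rewrite -eqp => /part_vertex_inj.
- elim/comp_ind=> [a|i a]; first by rewrite comp_leaf_base; split=> // /label0.
  by rewrite comp_leaf_part; have [_ _ lab _] := explNE i; apply: lab.
move=> x y xU yU xy; have [eqp|np] := eqVneq (part x) (part y); last first.
  apply: (iff_trans (lca0 xU yU np)); split=> -[w [lw tw]].
    by exists (inl w); split=> //; apply/comp_lca_parts => //; exists w.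
  by move/comp_lca_parts: lw => /(_ np) [w' eqw lw']; exists w'; split=> //; rewrite eqw in tw.
have [_ _ _ expl] := explNE (part x).
have xP : x \in P (part x) by rewrite inE xU eqxx.
have yP : y \in P (part x) by rewrite inE yU eqp eqxx.
apply: (iff_trans (expl x y xP yP xy)); rewrite /comp_leaf -eqp.
split=> -[w [lw tw]].
  by exists (part_vertex w); split=> //; apply/comp_lca_part; exists w.
by move/comp_lca_part: lw => [w' eqw lw']; exists w'; split=> //; rewrite eqw in tw.
Qed.

End Composition.

(** * Networks from polar-cats *)

Section GallDigraph.
Variables k l : nat.
Hypotheses (k_gt0 : 0 < k) (l_gt0 : 0 < l).
Let n := k + l.
Let W0 := 'I_n.+2.
Let nE : n = k + l. Proof. by []. Qed.

(* The two sides of the gall are [1 .. k] and [k + 1 .. n], from the root [0] down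
   to the hybrid [n + 1]. *)
Definition gall_edge : rel W0 := fun u w =>
  (0 < w) && if w <= n then u == (if (w == 1 :> nat) || (w == k.+1 :> nat) then 0 else w.-1) :> nat
             else (u == k :> nat) || (u == n :> nat).
Definition gall_reach : rel W0 := fun u w =>
  [|| u == w :> nat, u == 0 :> nat, w == n.+1 :> nat |
      [&& u <= w, w <= n & (w <= k) || (k < u)]].
(** The shift by one hangs part [i] off vertex [i.+1]: nothing hangs off the root, and the last part
    [n] hangs off the hybrid. *)
Definition gall_att (i : 'I_n.+1) : W0 := lift ord0 i.

Lemma gall_edge_incr x y : gall_edge x y -> x < y.
Proof.
rewrite /gall_edge => /andP[y0]; case: ifP; last by lia.
by move=> yn /eqP->; case: ifP; lia.
Qed.

Lemma gall_connectE : connect gall_edge =2 gall_reach.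
Proof.
apply: incr_connectE gall_edge_incr _ _ _ => [x|x y z|x z].
- by rewrite /gall_reach eqxx.
- have := ltn_ord y; have := ltn_ord z; rewrite /gall_edge /gall_reach.
  by case: ifP; [case: ifP|]; lia.
rewrite /gall_reach -val_eqE /= => R xz.
have ltz := ltn_ord z; have ltx := ltn_ord x.
have [zn|zn] := leqP z n.
  exists (inord (if (z == 1 :> nat) || (z == k.+1 :> nat) then 0 else z.-1)).
    rewrite /gall_edge zn inordK ?eqxx ?andbT; first by move: R xz; lia.
    by case: ifP; lia.
  rewrite inordK; last by case: ifP; lia.
  by move: R xz; case: ifP; lia.
exists (inord (if x <= k then k else n)).
  rewrite /gall_edge [z <= n]leqNgt zn /= inordK; last by case: ifP; lia.
  by case: ifP; rewrite eqxx ?orbT andbT; lia.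
rewrite inordK; last by case: ifP; lia.
by case: ifP; lia.
Qed.

Lemma gall_indeg w : indeg gall_edge w = if w == ord0 then 0 else if w <= n then 1 else 2.
Proof.
rewrite -val_eqE /= /indeg; have ltw := ltn_ord w; have [w0|w0] := eqVneq (w : nat) 0.
  by apply/eqP; rewrite cards_eq0; apply/eqP/setP=> u; rewrite !inE /gall_edge w0.
have [wn|wn] := leqP w n.
  rewrite -(cards1 (inord (if (w == 1 :> nat) || (w == k.+1 :> nat) then 0 else w.-1) : W0)).
  apply: eq_card => u; rewrite !inE /gall_edge wn lt0n w0 -val_eqE /= inordK //.
  by case: ifP; lia.
have vk : (inord k : W0) = k :> nat by rewrite inordK //; lia.
have vn : (inord n : W0) = n :> nat by rewrite inordK.
transitivity #|[set (inord k : W0); inord n]|.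
  apply: eq_card => u; rewrite !inE /gall_edge [w <= n]leqNgt wn lt0n w0 -!val_eqE /=.
  by rewrite vk vn.
by rewrite cards2 -val_eqE /= vk vn; lia.
Qed.

Lemma gall_att_card v : #|[set i | gall_att i == v]| = (v != ord0).
Proof.
have [->|v0] := eqVneq v ord0.
  apply/eqP; rewrite cards_eq0; apply/eqP/setP=> i; rewrite !inE.
  by rewrite eq_sym; apply/negbTE/neq_lift.
case: (unliftP ord0 v) v0 => [i -> _|->]; last by rewrite eqxx.
transitivity #|[set i]|; last by rewrite cards1.
apply: eq_card => j; rewrite !inE.
by rewrite /gall_att (inj_eq (@lift_inj _ ord0)).
Qed.

Lemma gall_outdeg v :
  (if indeg gall_edge v <= 1 then 2 else 1) <=
  outdeg gall_edge v + #|[set i | gall_att i == v]|.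
Proof.
rewrite gall_att_card gall_indeg; have [->|v0] /= := eqVneq v ord0.
  pose a : W0 := inord 1; pose b : W0 := inord k.+1.
  have va : a = 1 :> nat by rewrite /a inordK.
  have vb : b = k.+1 :> nat by rewrite /b inordK //; lia.
  rewrite addn0; suff -> : 2 = #|[set a; b]|.
    apply/subset_leq_card/subsetP=> w; rewrite !inE => /orP[] /eqP->.
      by rewrite /gall_edge va /=; case: ifP; lia.
    by rewrite /gall_edge vb /= eqxx orbT; case: ifP; lia.
  by rewrite cards2 -val_eqE /= va vb; lia.
have [vn|vn] //= := leqP v n; last by rewrite addn1.
rewrite addn1 ltnS; apply/card_gt0P.
move: v0; rewrite -val_eqE /= => v0.
have [vk|vk] := boolP ((v == k :> nat) || (v == n :> nat)).
  by exists ord_max; rewrite inE /gall_edge /= ltnn.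
exists (inord v.+1); rewrite inE /gall_edge inordK; last by lia.
have -> : v.+1 <= n by lia.
by case: ifP; lia.
Qed.

(** Meant for [i < j]; the part [n] below the hybrid counts as lying on both sides. *)
Definition same_gall_side i j := [|| j < k, k <= i | j == n].

(** The common ancestors are the ancestors of a single vertex: the upper attachment on a common
    side, the root otherwise. *)
Lemma gall_lca (i j : 'I_n.+1) w : i < j ->
  is_lca gall_edge (gall_att i) (gall_att j) w <->
  w = (if same_gall_side i j then i.+1 else 0) :> nat.
Proof.
move=> ij; have ltj := ltn_ord j; pose m := if same_gall_side i j then i.+1 else 0.
have mn : m < n.+2 by rewrite /m; case: ifP; lia.
pose c : W0 := Ordinal mn.
have anc u : connect gall_edge u (gall_att i) && connect gall_edge u (gall_att j) =
    gall_reach u c.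
  have ltu := ltn_ord u.
  rewrite !gall_connectE /gall_reach /gall_att /= /bump /= !add1n /m /same_gall_side.
  by case: ifP; lia.
split=> [[wa wb min]|wm].
  have := anc c; rewrite /gall_reach eqxx => /andP[ca cb].
  have := anc w; rewrite wa wb => /esym R.
  by rewrite -(min c ca cb) // gall_connectE.
have -> : w = c by apply: val_inj.
have := anc c; rewrite /gall_reach eqxx => /andP[ca cb]; split=> // u ua ub.
have := anc u; rewrite ua ub => /esym R cu; apply: (acyclic_connect_antisym _ _ cu).
  exact: incr_acyclic gall_edge_incr.
by rewrite gall_connectE.
Qed.

End GallDigraph.

(** * Explaining vertex sets by induction *)

Section Build.
Variables (V : finType) (e : rel V).
Hypothesis symE : symmetric e.
Implicit Types (U A B S M : {set V}).

Definition bool_label (b : bool) := if b then L1 else L0.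

Lemma explained_set1 x : explained e [set x].
Proof.
pose E : rel unit := fun _ _ => false.
have deg0 v : indeg E v = 0 /\ outdeg E v = 0.
  by split; apply/eqP; rewrite cards_eq0; apply/eqP/setP=> u; rewrite !inE.
exists (@Net V unit E tt (fun _ => tt) (fun _ => Lodot)); rewrite /net_explains /=.
have X v : v \in [set tt | _ in [set x]] by apply/imsetP; exists x; rewrite ?set11 ?(unitE v); case: v.
split=> [|y z /set1P-> /set1P-> //|v|y z /set1P-> /set1P->]; last by rewrite eqxx.
  split=> //.
  - by case=> //; apply: connect0.
  - by case: (deg0 tt).
  - by move=> v; rewrite X (deg0 v).2 eqxx.
  - by move=> v; rewrite X.
by rewrite X.
Qed.

(** The base digraph is a single vertex labelled by [c], with the networks of [A] and its complement
    in [U] attached. *)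
Lemma explained_split U A c : A \subset U ->
  (forall x y, x \in A -> y \in U -> y \notin A -> e x y = c) ->
  explained e A -> explained e (U :\: A) -> explained e U.
Proof.
move=> sub const [NA exA] [NB exB].
pose E0 : rel unit := fun _ _ => false.
have ind0 v : indeg E0 v = 0.
  by apply/eqP; rewrite cards_eq0; apply/eqP/setP=> u; rewrite !inE.
apply: (@comp_explained V e U bool (mem A) unit E0 tt (fun _ => tt) (fun _ => bool_label c) _ _ _ _ _ _ _ _
         (fun b => if b then NA else NB)) => //.
- by case=> //; apply: connect0.
- by move=> v; rewrite ind0.
- case; rewrite ind0 (leq_trans _ (leq_addl _ _)) // -card_bool.
  by apply/subset_leq_card/subsetP=> b; rewrite !inE.
- by move=> v; rewrite /bool_label; case: (c).
- move=> x y xU yU /= nxy.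
  have exy : e x y = c.
    move: nxy; have [xA|xA] := boolP (x \in A); have [yA|yA] //= := boolP (y \in A) => _.
      exact: const.
    by rewrite symE const.
  rewrite exy /bool_label; split=> [->|[_ [_]]]; last by case: (c).
  by exists tt; split=> //; split; rewrite ?connect0 // => -[].
case.
  suff -> : [set x in U | (x \in A) == true] = A by [].
  by apply/setP=> x; rewrite !inE eqb_id andb_idl // => /(subsetP sub).
suff -> : [set x in U | (x \in A) == false] = U :\: A by [].
by apply/setP=> x; rewrite !inE eqbF_neg andbC.
Qed.

(** In the list [s1 ++ rcons s2 v] position [i] matches the part attached to vertex [i.+1] of the
    gall digraph, so this formula is the counterpart of [gall_lca]. *)
Lemma gall_seq_edge (T : finType) (f : rel T) X v s1 s2 c x0 i j :
  gall_seq f X v s1 s2 -> (forall x y, x \in s1 -> y \in s2 -> f x y = c) ->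
  i < j -> j <= size s1 + size s2 ->
  f (nth x0 (s1 ++ rcons s2 v) i) (nth x0 (s1 ++ rcons s2 v) j) =
  if same_gall_side (size s1) (size s2) i j then f (nth x0 (s1 ++ rcons s2 v) i) v else c.
Proof.
case=> _ _ pw1 pw2 _ const ij jn; rewrite /same_gall_side !nth_cat.
have [jk|kj] /= := ltnP j (size s1).
  rewrite (ltn_trans ij jk); apply/eqP.
  by apply: (pairwiseP x0 pw1); rewrite ?inE // (ltn_trans ij jk).
rewrite !nth_rcons.
have [->|nj] := eqVneq j (size s1 + size s2).
  by rewrite orbT addKn ltnn eqxx.
have jl : j - size s1 < size s2 by lia.
rewrite jl orbF; have [ki|ik] := leqP (size s1) i; last by rewrite const ?mem_nth.
have il : i - size s1 < size s2 by lia.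
rewrite il; apply/eqP; apply: (pairwiseP x0 pw2); rewrite ?inE //; lia.
Qed.

Lemma explained_gall U v s1 s2 : 1 < #|U| ->
  gall_seq (quot_rel e) (Mmax e U) v s1 s2 -> s1 != [::] -> s2 != [::] ->
  (forall S, S \in Mmax e U -> explained e S) -> explained e U.
Proof.
move=> U1 gs n1 n2 exS; have [us defM _ _ [c const]] := gs.
set k := size s1; set l := size s2.
have [k0 l0] : 0 < k /\ 0 < l by rewrite /k /l; case: (s1) n1; case: (s2) n2.
set q := s1 ++ rcons s2 v; pose n := k + l.
have sq : size q = n.+1 by rewrite size_cat size_rcons addnS.
have memq S : (S \in q) = (S \in Mmax e U).
  rewrite defM !inE !mem_cat mem_rcons inE.
  by case: (S == v); case: (S \in s1).
have uq : uniq q.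
  move: us; rewrite /q -cats1 catA cats1 rcons_uniq /= => /andP[-> ->] //.
pose blk i := nth set0 q i.
have blkM i : i < n.+1 -> blk i \in Mmax e U by move=> lt; rewrite -memq mem_nth ?sq.
have blk_uniq i j : i < n.+1 -> j < n.+1 -> (blk i == blk j) = (i == j).
  by move=> il jl; rewrite nth_uniq ?sq.
pose part x : 'I_n.+1 := inord (find (fun S : {set V} => x \in S) q).
have partP x : x \in U -> x \in blk (part x).
  move=> xU; have [S SM xS] := Mmax_block e U1 xU.
  have hs : has (fun S : {set V} => x \in S) q by apply/hasP; exists S; rewrite ?memq.
  by rewrite /part inordK -?sq -?has_find //; apply: (nth_find set0 hs).
have part_eq (i : 'I_n.+1) : [set x in U | part x == i] = blk i.
  apply/setP=> x; rewrite !inE; apply/andP/idP=> [[xU /eqP<-]|xi]; first exact: partP.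
  have xU := subsetP (Mmax_sub (blkM i (ltn_ord i))) _ xi; split=> //.
  rewrite -val_eqE -[_ == _](blk_uniq _ _ (ltn_ord (part x)) (ltn_ord i)); apply/eqP.
  exact: Mmax_uniq (blkM _ (ltn_ord _)) (blkM _ (ltn_ord _)) (partP x xU) xi.
have [N exN] : exists N : 'I_n.+1 -> net V, forall i, net_explains e [set x in U | part x == i] (N i).
  apply: (@fin_all_exists _ (fun=> net V)
    (fun i N => net_explains e [set x in U | part x == i] N)) => i.
  by rewrite part_eq; apply: exS; apply: blkM.
(* The root decides pairs across the sides, a side vertex the adjacency of its block to all later
   ones on its side, which is that to [v]. *)
pose t0 (w : 'I_n.+2) := bool_label (if w == ord0 then c else quot_rel e (blk w.-1) v).
have edge x y : x \in U -> y \in U -> part x < part y ->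
   (e x y <-> exists w, is_lca (@gall_edge k l) (gall_att (part x)) (gall_att (part y)) w /\ t0 w = L1).
  move=> xU yU lt; have [ltx lty] := (ltn_ord (part x), ltn_ord (part y)).
  have neq : blk (part x) != blk (part y) by rewrite blk_uniq // neq_ltn lt.
  rewrite -(quot_rel_edge symE (blkM _ ltx) (blkM _ lty) neq (partP _ xU) (partP _ yU)).
  rewrite /blk (gall_seq_edge set0 gs const lt) // -/q -/k -/l.
  set m := if same_gall_side k l (part x) (part y) then (part x).+1 else 0.
  have tE (w : 'I_n.+2) : w = m :> nat -> t0 w =
      bool_label (if same_gall_side k l (part x) (part y) then quot_rel e (nth set0 q (part x)) v else c).
    by move=> wm; rewrite /t0 -val_eqE /= wm /m; case: (same_gall_side _ _ _ _).
  split=> [h|[w [lw tw]]]; last first.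
    have wm := (gall_lca k0 l0 w lt).1 lw.
    by move: tw; rewrite (tE w wm) /bool_label; case: (if same_gall_side _ _ _ _ then _ else _).
  have mn : m < n.+2 by rewrite /m; case: ifP.
  exists (Ordinal mn); split; first by apply/(gall_lca k0 l0 _ lt).
  by rewrite tE // h.
have degE w := @gall_indeg k l k0 l0 w.
apply: (@comp_explained V e U _ part _ (@gall_edge k l) ord0 (@gall_att k l) t0 _ _ _ _ _ _ _ _ N) => //.
- exact: incr_acyclic (@gall_edge_incr k l k0 l0).
- by move=> w; rewrite gall_connectE // /gall_reach eqxx orbT.
- by move=> w /negPf w0; rewrite degE w0; case: ifP; [left|right].
- have hyb (w : 'I_n.+2) : 1 < indeg (@gall_edge k l) w -> w = ord_max.
    rewrite degE; case: eqP => // _; case: ifP => // nw _; apply: val_inj => /=.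
    by have := ltn_ord w; rewrite -/n in nw *; lia.
  by move=> h h' /hyb-> /hyb->.
- exact: gall_outdeg.
- by move=> w; rewrite /t0 /bool_label; case: (if w == ord0 then _ else _).
move=> x y xU yU nxy; have [lt|lt|eqp] := ltngtP (part x) (part y).
- exact: edge.
- by rewrite symE (edge y x yU xU lt); apply: lca_label_sym.
- by case/eqP: nxy; apply: val_inj.
Qed.

(** [PolarCat_prime] relative to a vertex set, so that the induction can pass it to smaller sets. *)
Definition prime_polar_cat U := forall M, strong_in e U M -> connb e M ->
  connb (compl_rel e) M -> 2 <= #|M| -> polar_cat (quot_rel e) (Mmax e M).

(** A module of [U] that meets [M] without containing it meets [S] without containing it, so it lies
    in [S] and is a module there. *)
Lemma strong_trans U S M : strong_in e U S -> strong_in e S M -> strong_in e U M.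
Proof.
move=> sS sM; have [mS HS] := strong_inP _ _ _ sS; have [mM HM] := strong_inP _ _ _ sM.
have [subS modS] := module_inP _ _ _ mS; have [subM modM] := module_inP _ _ _ mM.
apply/strong_inP; split.
  apply/module_inP; split=> [|x y z xM yM zU zM]; first exact: subset_trans subS.
  have [zS|zS] := boolP (z \in S); first exact: modM.
  by apply: modS => //; apply: (subsetP subM).
move=> S' x y z mS' xM xS' yM yS' zS'.
have [xS yS] := (subsetP subM _ xM, subsetP subM _ yM).
have sub' : S' \subset S.
  by apply/subsetP=> w wS'; apply: (HS S' x y w).
have [_ modS'] := module_inP _ _ _ mS'.
apply: (HM S' x y z) => //; apply/module_inP; split=> // a b w aS' bS' wS wS'.
by apply: modS' => //; apply: (subsetP subS).
Qed.

Lemma prime_polar_cat_strong U S : strong_in e U S -> prime_polar_cat U ->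
  prime_polar_cat S.
Proof. by move=> sS H M sM; apply: H; apply: strong_trans sM. Qed.

(** A prime strong module [M] of [A] stays strong in [U]. An overlapping module [S'] with a point
    [z] outside [A] would make every pair between [M :&: S'] and [M :\: S'] have adjacency [c],
    against [prime_cross]. *)
Lemma prime_polar_cat_split U A c : A \subset U ->
  (forall x y, x \in A -> y \in U -> y \notin A -> e x y = c) ->
  prime_polar_cat U -> prime_polar_cat A.
Proof.
move=> sub const H M sM co coc M2; apply: H => //.
have [mM HM] := strong_inP _ _ _ sM; have [subM modM] := module_inP _ _ _ mM.
apply/strong_inP; split.
  apply/module_inP; split=> [|x y z xM yM zU zM]; first exact: subset_trans sub.
  have [zA|zA] := boolP (z \in A); first exact: modM.
  by rewrite !const // (subsetP subM).
move=> S' x y z mS' xM xS' yM yS' zS'; have [subS' modS'] := module_inP _ _ _ mS'.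
have zU := subsetP subS' _ zS'.
have [zA|zA] := boolP (z \in A).
  have xA := subsetP subM _ xM.
  apply: (HM (S' :&: A) x y z); rewrite ?inE ?xS' ?zS' ?(negPf yS') //.
  apply/module_inP; split=> [|a b w]; first exact: subsetIr.
  rewrite !inE => /andP[aS' aA] /andP[bS' bA] wA; rewrite wA andbT => wS'.
  by apply: modS' => //; apply: (subsetP sub).
have [u [w [uM wM uS' wS' euw]]] := prime_cross (~~ c) co coc xM xS' yM yS'.
have wA := subsetP subM _ wM; have wU := subsetP sub _ wA.
have := modS' u z w uS' zS' wU wS'; rewrite euw (symE z w) const //.
by case: (c).
Qed.

Lemma not_connb_split (R : rel V) U : ~~ connb R U -> exists A a b,
  [/\ A \subset U, a \in A, b \in U :\: A &
      forall x y, x \in A -> y \in U -> y \notin A -> ~~ R x y].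
Proof.
rewrite negb_forall => /existsP[a]; rewrite negb_imply => /andP[aU].
rewrite negb_forall => /existsP[b]; rewrite negb_imply => /andP[bU nab].
exists [set z in U | connect (restr R U) a z], a, b; split.
- by apply/subsetP=> z /setIdP[].
- by rewrite inE aU connect0.
- by rewrite !inE bU (negPf nab).
move=> x y; rewrite !inE => /andP[xU ax] yU; rewrite yU; apply: contraNN => Rxy.
by apply: connect_trans ax (connect1 _); apply/and3P.
Qed.

Lemma prime_polar_cat_explained U : 0 < #|U| -> prime_polar_cat U -> explained e U.
Proof.
have [m] := ubnP #|U|; elim: m U => // m IH U ltm U0 H.
have [U1|U1] := leqP #|U| 1.
  have /cards1P[x ->] : #|U| == 1 by rewrite eqn_leq U1 U0.
  exact: explained_set1.
have split A a b c : A \subset U -> a \in A -> b \in U :\: A ->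
    (forall x y, x \in A -> y \in U -> y \notin A -> e x y = c) -> explained e U.
  move=> sub aA bB const.
  have cA : 0 < #|A| by apply/card_gt0P; exists a.
  have cB : 0 < #|U :\: A| by apply/card_gt0P; exists b.
  have := cardsD U A; rewrite (setIidPr sub) => cUA.
  have leA := subset_leq_card sub.
  apply: (explained_split sub const); apply: IH => //; try lia.
    exact: prime_polar_cat_split sub const H.
  apply: (@prime_polar_cat_split U (U :\: A) c (subsetDl _ _)) H => x y.
  rewrite !inE => /andP[xA xU] yU; rewrite yU andbT negbK => yA.
  by rewrite symE const.
have [co|/not_connb_split[A [a [b [sub aA bB Rn]]]]] := boolP (connb e U); last first.
  by apply: (split A a b false) => // x y xA yU yA; apply/negbTE/Rn.
have [coc|/not_connb_split[A [a [b [sub aA bB Rn]]]]] := boolP (connb (compl_rel e) U); last first.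
  apply: (split A a b true) => // x y xA yU yA; have := Rn x y xA yU yA.
  by rewrite /compl_rel /= negb_and !negbK => /orP[/eqP xy|//]; rewrite -xy xA in yA.
have sU : strong_in e U U.
  apply/strong_inP; split=> [|S' x y z mS' _ _ _ _ zS'].
    by apply/module_inP; split=> // x y z _ _ ->.
  by have [sub _] := module_inP _ _ _ mS'; apply: (subsetP sub).
have [v [s1 [s2 [gs n1 n2]]]] := polar_cat_gall_seq (H U sU co coc U1).
apply: (explained_gall U1 gs n1 n2) => S SM; have [sS SU _] := MmaxP SM.
have [x xS] := Mmax_nonempty U1 SM.
apply: IH; last exact: prime_polar_cat_strong H.
  rewrite -ltnS (leq_trans _ ltm) // ltnS; apply: proper_card.
  by rewrite properEneq SU (Mmax_sub SM).
by apply/card_gt0P; exists x.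
Qed.

End Build.

(** * From cut certificates to level-1 networks, and the equivalence *)

Lemma cut_not_biconnb (W : finType) (E : rel W) r h h' (B : {set W}) :
  separated_by_cut E r h h' -> biconnb (und E) B -> h \in B -> h' \in B -> False.
Proof.
case=> c [S [ch ch' /andP[_ cS] hS H]] bB hB h'B.
have co := biconnb_connbD1 c bB.
have aux x y : x \in B -> y \in B -> c != x -> c != y -> x \in S -> y \notin S -> False.
  move=> xB yB cx cy xS yS.
  have xBc : x \in B :\ c by rewrite !inE eq_sym cx.
  have yBc : y \in B :\ c by rewrite !inE eq_sym cy.
  have [a [b [_ bBc aS bS Eab]]] := connb_exit (P := mem S) co xBc yBc xS yS.
  have bc : b != c by move: bBc; rewrite !inE => /andP[].
  by have := H a b aS bS bc; rewrite Eab.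
by move: hS; case: (boolP (h \in S)); case: (boolP (h' \in S)) => // ? ? _;
  [apply: (aux h h') | apply: (aux h' h)].
Qed.

Lemma explained_setT (V : finType) (e : rel V) : explained e [set: V] -> L1_explainable e.
Proof.
case=> -[W E r leaf t]; rewrite /net_explains /= => -[net inj lab expl].
exists W, E, leaf, t; split=> //; last 2 first.
- move=> B mxB; apply/card_le1_eqP=> h h'; rewrite !inE => /andP[hB /andP[/eqP hh _]].
  case/andP=> h'B /andP[/eqP hh' _]; apply/eqP/negPn/negP=> nhh'.
  have cut := net_cut net nhh'; rewrite hh hh' in cut.
  by apply: (cut_not_biconnb (cut isT isT) (maxsetp mxB)).
- by move=> x y xy; apply: expl; rewrite ?inE.
- split; first exact: net_acyclic net.
  (* A root that is a leaf has no outgoing edge, yet reaches every vertex: this is the one-vertex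
     network. *)
  have [rX|rX] := boolP (r \in leaf @: [set: V]).
    left; have out0 : forall v, ~~ E r v.
      move=> v; move: rX; rewrite (net_leaf_outdeg net) cards_eq0 => /eqP/setP/(_ v).
      by rewrite !inE => ->.
    have all_r v : v = r.
      apply/eqP/negPn/negP=> vr; have := net_root_connect net v.
      by case/connectP=> -[|w p] /=; [move=> _ eqv; rewrite eqv eqxx in vr | rewrite (negPf (out0 w))].
    split; [|split].
    + by rewrite -cardsT -(cards1 r); apply: eq_card => v; rewrite !inE (all_r v) eqxx.
    + by apply/setP=> v; rewrite inE (all_r v).
    + by move=> u v; rewrite (all_r u).
  right; split.
    exists r; split.
    + exact: net_root_indeg net.
    + by apply: (net_inner_outdeg net rX); rewrite (net_root_indeg net).
    + move=> r' r'0 _; apply/eqP/negPn/negP=> r'r.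
      by have [|[]] := net_inner_indeg net r'r; rewrite r'0.
    + move=> v vX vr; have [d1|[d2 _]] := net_inner_indeg net vr; [left|right].
        by rewrite /tree_vertexb d1 (net_inner_outdeg net vX) ?d1.
      by rewrite /hybridb d2 lt0n -(net_leaf_outdeg net).
  move=> x; split=> [xX|[out0 _]]; last by rewrite (net_leaf_outdeg net) out0.
  split; first by apply/eqP; rewrite -(net_leaf_outdeg net).
  have xr : x != r by apply: contraNneq rX => <-.
  by have [//|[_]] := net_inner_indeg net xr; rewrite xX.
- by move=> x y; apply: inj; rewrite inE.
Qed.

Theorem mainTheorem1 (V : finType) (e : rel V) :
  symmetric e -> irreflexive e -> 0 < #|V| ->
  (L1_explainable e <-> PolarCat_prime e).
Proof.
move=> symE _ V0; split; first exact: explainable_PolarCat_prime.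
move=> H; apply: explained_setT; apply: prime_polar_cat_explained => //.
  by rewrite cardsT.
by move=> M sM co coc M2; apply: H => //; apply/and3P.
Qed.
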